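(* Let $\mathbb{K}$ be a field of characteristic zero, $r\ge3$ an integer and $0\ne t\in\mathbb{K}$. Let $\mathcal{A}_{r,t}\subset\mathbb{K}^{r+1}$ be the arrangement with defining polynomial $$x_0\Big(\prod_{i=1}^r(x_i^2-x_0^2)\Big)(x_1-x_2)(x_2-x_3)\cdots(x_{r-1}-x_r)(x_r-tx_1),$$ let $H_0=\{x_0=0\}$, let $\mathcal{A}_{r,t}^{H_0}$ be the restriction to $H_0$, with defining polynomial $\big(\prod_{i=1}^rx_i\big)(x_1-x_2)\cdots(x_{r-1}-x_r)(x_r-tx_1)$, and let $\mathbf{m}^{H_0}$ be the Ziegler multiplicity, so that $(\mathcal{A}_{r,t}^{H_0},\mathbf{m}^{H_0})$ has defining polynomial $\big(\prod_{i=1}^rx_i^2\big)(x_1-x_2)\cdots(x_{r-1}-x_r)(x_r-tx_1)$. If $t\ne1$, then: (1) $(\mathcal{A}_{r,t}^{H_0},\mathbf{m}^{H_0})$ is free for $t\ne0,1$. (2) $\mathcal{A}_{r,t}$ is free if and only if $t=-1$. (3) The minimal free resolution of $D(\mathcal{A}_{r,t}^{H_0})$ is a twisted and truncated Koszul complex, $\mathrm{reg}(D(\mathcal{A}_{r,t}^{H_0}))=3$, and $\mathrm{pdim}(D(\mathcal{A}_{r,t}^{H_0}))=r-2$ (the maximum).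
   Context: For an arrangement $\mathcal{A}$ of linear hyperplanes $H=\ker\alpha_H$ in a vector space $V$ over $\mathbb{K}$ and a multiplicity $\mathbf{m}:\mathcal{A}\to\mathbb{Z}_{>0}$, with $S=\mathrm{Sym}(V^* )$, let $D(\mathcal{A},\mathbf{m})=\{\theta\in\mathrm{Der}_{\mathbb{K}}(S):\theta(\alpha_H)\in\langle\alpha_H^{\mathbf{m}(H)}\rangle\ \forall H\in\mathcal{A}\}$ and $D(\mathcal{A})=D(\mathcal{A},1)$. $(\mathcal{A},\mathbf{m})$ (resp. $\mathcal{A}$) is free if $D(\mathcal{A},\mathbf{m})$ (resp. $D(\mathcal{A})$) is a free $S$-module. The defining polynomial of $(\mathcal{A},\mathbf{m})$ is $\prod_H\alpha_H^{\mathbf{m}(H)}$, and that of $\mathcal{A}$ is $\prod_H\alpha_H$. These modules are graded by polynomial degree of coefficients, so $\partial/\partial x_i$ has degree $0$. The restriction $\mathcal{A}^{H_0}$ is the arrangement $\{H\cap H_0:H\in\mathcal{A},H\ne H_0\}$ in $H_0$; the Ziegler multiplicity is $\mathbf{m}^{H_0}(X)=\#\{H'\in\mathcal{A}:H'\cap H_0=X\}$, counted over $H'\neq H_0$. $D(\mathcal{A}_{r,t}^{H_0})$ is a module over $\mathbb{K}[x_1,\dots,x_r]$. $\mathrm{reg}$ is Castelnuovo–Mumford regularity and $\mathrm{pdim}$ projective dimension; the projective dimension of the derivation module of an arrangement of rank $r$ is at most $r-2$.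
   Formalization: In (3) the minimal free resolution is shown to be the twisted, truncated Koszul complex plus a free summand S(-1) in homological degree 0 spanned by the Euler derivation; without it the claim fails, since the derivation module has rank r and no truncated Koszul complex resolves a rank r module. *)

(* Defs.v *)
From HB Require Import structures.
From mathcomp Require Import all_boot all_order all_algebra zify.
From mathcomp.multinomials Require Export mpoly.

Set Implicit Arguments.
Unset Strict Implicit.
Unset Printing Implicit Defensive.

Import GRing.Theory.
Local Open Scope ring_scope.

(** * Modules

A module is given as a submodule [M : V -> Prop] of an ambient module [V]. *)

Section Modules.
Variables (R : nzRingType) (V : lmodType R).
Implicit Type M : V -> Prop.

Definition is_submodule M : Prop :=
  M 0 /\ forall (a : R) x y, M x -> M y -> M (a *: x + y).

(* [B] is a possibly infinite set of vectors. *)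
Definition is_basis M (B : V -> Prop) : Prop :=
  [/\ forall b, B b -> M b,
      forall x, M x -> exists (s : seq V) (c : V -> R),
        {in s, forall b, B b} /\ x = \sum_(b <- s) c b *: b
    & forall (s : seq V) (c : V -> R),
        uniq s -> {in s, forall b, B b} -> \sum_(b <- s) c b *: b = 0 ->
        {in s, forall b, c b = 0}].

Definition is_free M : Prop := exists B, is_basis M B.

Definition is_projective (P : lmodType R) : Prop :=
  forall (X Y : lmodType R) (g : {linear X -> Y}) (f : {linear P -> Y}),
    (forall y, exists x, g x = y) ->
    exists h : {linear P -> X}, forall p, g (h p) = f p.

(* [M] has a projective resolution 0 -> P_n -> ... -> P_0 -> M -> 0. *)
Definition pdim_le M (n : nat) : Prop :=
  exists (P : nat -> lmodType R) (d : forall i, {linear P i.+1 -> P i})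
         (e : {linear P 0%N -> V}),
    [/\ forall i, is_projective (P i),
        forall i, (n < i)%N -> forall p : P i, p = 0,
        forall x, M x <-> exists p, x = e p,
        forall p, e p = 0 <-> exists q, p = d 0%N q
      & forall i p, d i p = 0 <-> exists q, p = d i.+1 q].

Definition has_pdim M (n : nat) : Prop :=
  pdim_le M n /\ forall m, pdim_le M m -> (n <= m)%N.

End Modules.

(** * Graded free complexes over [K[x_0, ..., x_(n-1)]] *)

Section GradedComplexes.
Variables (K : fieldType) (n : nat).
Local Notation S := {mpoly K[n]}.

(* In homological degree [i] the free module with basis [cbas i], the basis
   element [k] having degree [cdeg k], i.e. the sum of the S(- cdeg k); the
   differential maps the basis element [k] to the sum of the [cdif k l *: l]. *)
Record gcomplex := GComplex {
  cbas : nat -> finType;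
  cdeg : forall i, cbas i -> nat;
  cdif : forall i, cbas i.+1 -> cbas i -> S
}.

Definition dmap (C : gcomplex) (i : nat) (c : {ffun cbas C i.+1 -> S}) :
    {ffun cbas C i -> S} :=
  [ffun l => \sum_k c k * cdif k l].

Definition augmap (C : gcomplex) (V : lmodType S) (e : cbas C 0 -> V)
    (c : {ffun cbas C 0 -> S}) : V :=
  \sum_k c k *: e k.

(* The rows of ['rV[S]_m] with all entries homogeneous of degree [d] are the
   elements of degree [d], so the standard basis of ['rV[S]_m] has degree 0. *)
Definition graded_free_resolution (m : nat) (M : 'rV[S]_m -> Prop)
    (C : gcomplex) (e : cbas C 0 -> 'rV[S]_m) : Prop :=
  [/\ forall k j, e k 0 j \is (cdeg k).-homog,
      forall i (k : cbas C i.+1) (l : cbas C i),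
        cdif k l \is (cdeg k - cdeg l).-homog /\
        ((cdeg k < cdeg l)%N -> cdif k l = 0),
      forall x, M x <-> exists c, x = augmap e c,
      forall c, augmap e c = 0 <-> exists b, c = dmap b
    & forall i (c : {ffun cbas C i.+1 -> S}),
        dmap c = 0 <-> exists b, c = dmap b].

(* The differential maps C_(i+1) into (x_0, ..., x_(n-1)) C_i. *)
Definition is_minimal (C : gcomplex) : Prop :=
  forall i (k : cbas C i.+1) (l : cbas C i), (cdif k l)@_0%MM = 0.

Definition min_free_resolution (m : nat) (M : 'rV[S]_m -> Prop)
    (C : gcomplex) (e : cbas C 0 -> 'rV[S]_m) : Prop :=
  graded_free_resolution M e /\ is_minimal C.

(* Castelnuovo-Mumford regularity: the maximum of (b - i) over the summands
   S(-b) in homological degree i of the minimal graded free resolution, which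
   is unique up to isomorphism. *)
Definition has_reg (m : nat) (M : 'rV[S]_m -> Prop) (d : nat) : Prop :=
  exists (C : gcomplex) (e : cbas C 0 -> 'rV[S]_m),
    [/\ min_free_resolution M e,
        forall i (k : cbas C i), (cdeg k <= d + i)%N
      & exists i, exists k : cbas C i, cdeg k = (d + i)%N].

Definition truncate (j : nat) (C : gcomplex) : gcomplex :=
  @GComplex (fun i => cbas C (i + j)) (fun i k => cdeg k)
            (fun i k l => @cdif C (i + j) k l).

(* C(-d) *)
Definition twist (d : nat) (C : gcomplex) : gcomplex :=
  @GComplex (cbas C) (fun i k => (cdeg k + d)%N) (fun i k l => cdif k l).

Definition dsum (C D : gcomplex) : gcomplex :=
  @GComplex (fun i => (cbas C i + cbas D i)%type)
    (fun i k => match k with inl k => cdeg k | inr k => cdeg k end)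
    (fun i k l => match k, l with
                  | inl k, inl l => cdif k l
                  | inr k, inr l => cdif k l
                  | _, _ => 0
                  end).

(* S in homological degree 0 *)
Definition unit_complex : gcomplex :=
  @GComplex (fun i => if i is 0%N then unit else void) (fun i k => 0%N)
            (fun i k l => 0).

(* The Koszul complex of x_0, ..., x_(n-1): e_I is sent to the sum over i in I
   of (-1)^#{j in I | j < i} x_i e_(I \ i). *)
Definition koszul : gcomplex :=
  @GComplex (fun p => {I : {set 'I_n} | #|I| == p}) (fun p I => p)
    (fun p I J => \sum_(i in val I | val J == val I :\ i)
                    (-1) ^+ #|[set j in val I | (j < i)%N]| * 'X_i).

End GradedComplexes.

(** * Multi-arrangements *)

Section Arrangements.
Variable K : fieldType.

Section Derivations.
Variable n : nat.
Local Notation S := {mpoly K[n]}.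

(* The linear form with coefficients [a], and its kernel. *)
Definition linform (a : 'rV[K]_n) : S := \sum_i a 0 i *: 'X_i.

Definition hyp (a : 'rV[K]_n) : {vspace 'rV[K]_n} :=
  lker (linfun (mulmxr a^T) : 'Hom('rV[K]_n, 'rV[K]_1)).

(* The row [theta] is the derivation sum_i theta_i d/dx_i; by
   [derivation_derapp] these are all the K-linear derivations of S. *)
Definition derapp (theta : 'rV[S]_n) (f : S) : S :=
  \sum_i theta 0 i * f^`M(i).

(* D(A, m). The forms [a] with kernel H are nonzero multiples of each other. *)
Definition derlog (A : seq {vspace 'rV[K]_n}) (m : {vspace 'rV[K]_n} -> nat)
    (theta : 'rV[S]_n) : Prop :=
  forall (H : {vspace 'rV[K]_n}) (a : 'rV[K]_n), H \in A -> H = hyp a ->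
    exists q : S, derapp theta (linform a) = q * linform a ^+ m H.

Definition simple (H : {vspace 'rV[K]_n}) : nat := 1%N.

Definition defining_polynomial (A : seq {vspace 'rV[K]_n})
    (m : {vspace 'rV[K]_n} -> nat) (Q : S) : Prop :=
  exists alpha : {vspace 'rV[K]_n} -> 'rV[K]_n,
    {in A, forall H, alpha H != 0 /\ H = hyp (alpha H)} /\
    Q = \prod_(H <- A) linform (alpha H) ^+ m H.

(* A^(H0) and the Ziegler multiplicity m^(H0), inside the ambient space. *)
Definition restriction (A : seq {vspace 'rV[K]_n}) (H0 : {vspace 'rV[K]_n}) :
    seq {vspace 'rV[K]_n} :=
  undup [seq (H :&: H0)%VS | H <- A & H != H0].

Definition ziegler (A : seq {vspace 'rV[K]_n}) (H0 X : {vspace 'rV[K]_n}) :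
    nat :=
  count (fun H => (H != H0) && ((H :&: H0)%VS == X)) A.

(* The coefficients of the form x_i, for [i < n]. *)
Definition xvec (i : nat) : 'rV[K]_n := \row_j (j == i :> nat)%:R.

End Derivations.

(* Transport of (A, m) along an injective [iota] whose image contains the
   members of A: coordinates on the space where A lives. *)
Definition coords (n p : nat) (iota : 'Hom('rV[K]_p, 'rV[K]_n))
    (A : seq {vspace 'rV[K]_n}) : seq {vspace 'rV[K]_p} :=
  [seq (iota @^-1: H)%VS | H <- A].

Definition coords_mult (n p : nat) (iota : 'Hom('rV[K]_p, 'rV[K]_n))
    (m : {vspace 'rV[K]_n} -> nat) : {vspace 'rV[K]_p} -> nat :=
  fun H => m (iota @: H)%VS.

(* The inclusion (x_1, ..., x_r) |-> (0, x_1, ..., x_r) of {x_0 = 0}. In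
   K[x_1, ..., x_r], taken to be {mpoly K[r]}, x_i is thus ['X_(i - 1)]. *)
Definition incl0 (r : nat) : 'Hom('rV[K]_r, 'rV[K]_r.+1) :=
  linfun (mulmxr (row_mx 0 1%:M : 'M[K]_(r, 1 + r))).

(** * The arrangement A_(r,t) *)

Definition Art_forms (r : nat) (t : K) : seq 'rV[K]_r.+1 :=
  let x := @xvec r.+1 in
  x 0%N :: [seq x i - x 0%N | i <- iota 1 r] ++ [seq x i + x 0%N | i <- iota 1 r]
  ++ [seq x i - x i.+1 | i <- iota 1 r.-1] ++ [:: x r - t *: x 1%N].

Definition Art (r : nat) (t : K) : seq {vspace 'rV[K]_r.+1} :=
  [seq hyp a | a <- Art_forms r t].

Definition H0 (r : nat) : {vspace 'rV[K]_r.+1} := hyp (xvec r.+1 0).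

(* The restriction of A_(r,t) to H0 and its Ziegler multiplicity, in the
   coordinates x_1, ..., x_r of H0. *)
Definition ArtH0 (r : nat) (t : K) : seq {vspace 'rV[K]_r} :=
  coords (incl0 r) (restriction (Art r t) (H0 r)).

Definition mH0 (r : nat) (t : K) : {vspace 'rV[K]_r} -> nat :=
  coords_mult (incl0 r) (ziegler (Art r t) (H0 r)).

End Arrangements.

Arguments simple {K n} H.
Arguments ArtH0 {K} r t.
Arguments mH0 {K} r t H.

Section Facts.
Variable K : fieldType.

Lemma derlog_submodule n (A : seq {vspace 'rV[K]_n}) m :
  is_submodule (derlog A m).
Proof.
split=> [H a _ _|p x y Dx Dy H a HA Ha].
  by exists 0; rewrite mul0r /derapp big1 // => i _; rewrite mxE mul0r.
have [q Eq] := Dx H a HA Ha; have [q' Eq'] := Dy H a HA Ha.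
exists (p * q + q'); rewrite mulrDl -mulrA -Eq -Eq' /derapp mulr_sumr -big_split.
by apply: eq_bigr => i _; rewrite !mxE mulrDl mulrA.
Qed.

Lemma derivation_derapp n (delta : {mpoly K[n]} -> {mpoly K[n]}) :
    (forall (c : K) f g, delta (c *: f + g) = c *: delta f + delta g) ->
    (forall f g, delta (f * g) = delta f * g + f * delta g) ->
  forall f, delta f = derapp (\row_i delta 'X_i) f.
Proof.
move=> linD leib.
have linA (theta : 'rV[{mpoly K[n]}]_n) (c : K) f g :
    derapp theta (c *: f + g) = c *: derapp theta f + derapp theta g.
  rewrite /derapp scaler_sumr -big_split; apply: eq_bigr => i _ /=.
  by rewrite mderivD mderivZ mulrDr scalerAr.
have leibA (theta : 'rV[{mpoly K[n]}]_n) f g :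
    derapp theta (f * g) = derapp theta f * g + f * derapp theta g.
  rewrite /derapp mulr_suml mulr_sumr -big_split; apply: eq_bigr => i _ /=.
  by rewrite mderivM mulrDr [f * (_ * _)]mulrCA !mulrA.
set theta := \row_i _.
have d0 : delta 0 = 0.
  have := linD 1 0 0; rewrite !scale1r add0r -[X in X = _]addr0.
  by move/addrI/esym.
have a0 : derapp theta 0 = 0.
  by rewrite /derapp big1 // => i _; rewrite mderiv0 mulr0.
have d1 : delta 1 = 0.
  have := leib 1 1; rewrite !mul1r mulr1 -[X in X = _]addr0.
  by move/addrI/esym.
have a1 : derapp theta 1 = 0.
  by rewrite /derapp big1 // => i _; rewrite -mpolyC1 mderivC mulr0.
have eqX (m : 'X_{1..n}) : delta 'X_[m] = derapp theta 'X_[m].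
  rewrite mpolyXE_id; apply: (big_ind (fun f => delta f = derapp theta f)).
  - by rewrite d1 a1.
  - by move=> f g Ef Eg; rewrite leib leibA Ef Eg.
  move=> i _; elim: (m i) => [|k IH]; first by rewrite expr0 d1 a1.
  rewrite exprS leib leibA IH; congr (_ * _ + _).
  rewrite /derapp (bigD1 i) //= mderivX mnm1E eqxx scale1r.
  rewrite -[X in (X - _)%MM]add0m addmK mpolyX0 mulr1 big1 ?addr0 ?mxE // => j ji.
  by rewrite mderivX mnm1E eq_sym (negbTE ji) scale0r mulr0.
elim/mpolyind => [|c m p _ _ IH]; first by rewrite d0 a0.
by rewrite linD linA eqX IH.
Qed.

Lemma linform_xvec n (i : 'I_n) : linform (xvec K n i) = 'X_i.
Proof.
rewrite /linform (bigD1 i) //= mxE eqxx scale1r big1 ?addr0 // => j ji.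
by rewrite mxE val_eqE (negbTE ji) scale0r.
Qed.

Lemma linformD n (a b : 'rV[K]_n) : linform (a + b) = linform a + linform b.
Proof.
by rewrite /linform -big_split; apply: eq_bigr => i _; rewrite mxE scalerDl.
Qed.

Lemma linformZ n c (a : 'rV[K]_n) : linform (c *: a) = c *: linform a.
Proof.
by rewrite /linform scaler_sumr; apply: eq_bigr => i _; rewrite mxE scalerA.
Qed.

Lemma linformB n (a b : 'rV[K]_n) : linform (a - b) = linform a - linform b.
Proof. by rewrite linformD -scaleN1r linformZ scaleN1r. Qed.

Lemma mem_hyp n (a v : 'rV[K]_n) : (v \in hyp a) = (v *m a^T == 0).
Proof. by rewrite /hyp memv_ker lfunE. Qed.

Lemma hyp_minor n (a b : 'rV[K]_n) : hyp a = hyp b ->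
  forall i j, a 0 i * b 0 j = a 0 j * b 0 i.
Proof.
move=> ab i j; pose v := a 0 j *: delta_mx 0 i - a 0 i *: delta_mx 0 j : 'rV[K]_n.
have E (c : 'rV[K]_n) : v *m c^T = (a 0 j * c 0 i - a 0 i * c 0 j)%:M.
  apply/rowP => k; rewrite !ord1 mulmxBl -!scalemxAl -!rowE !mxE eqxx.
  by rewrite mulr1n.
have : v \in hyp a.
  rewrite mem_hyp E; apply/eqP/rowP => k.
  by rewrite !ord1 !mxE eqxx mulr1n mulrC subrr.
rewrite ab mem_hyp E => /eqP/rowP/(_ 0); rewrite !mxE eqxx mulr1n => /eqP.
by rewrite subr_eq0 => /eqP.
Qed.

Lemma hyp_supp n (a b : 'rV[K]_n) : hyp a = hyp b -> a != 0 -> b != 0 ->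
  forall i, (a 0 i == 0) = (b 0 i == 0).
Proof.
have wlg (c d : 'rV[K]_n) i : hyp c = hyp d -> d != 0 -> d 0 i = 0 -> c 0 i = 0.
  move=> cd d0 di; apply/eqP/negPn/negP => ci; case/negP: d0.
  apply/eqP/rowP => j; rewrite mxE.
  have := hyp_minor cd i j; rewrite di mulr0 => /eqP.
  by rewrite mulf_eq0 (negbTE ci) => /eqP.
move=> ab a0 b0 i; apply/eqP/eqP; first exact: wlg.
exact: wlg.
Qed.

Lemma hyp_defining_polynomial n (s : seq 'rV[K]_n) m :
    all (fun a => a != 0) s -> uniq [seq hyp a | a <- s] ->
  defining_polynomial [seq hyp a | a <- s] m
    (\prod_(a <- s) linform a ^+ m (hyp a)).
Proof.
move=> s0 us; exists (fun H => nth 0 s (index H [seq hyp a | a <- s])).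
split=> [H Hs|].
  have lt : (index H [seq hyp a | a <- s] < size s)%N.
    by rewrite -(size_map (@hyp K n)) index_mem.
  split; first by apply: (allP s0); rewrite mem_nth.
  by rewrite -(nth_map 0 (hyp 0)) ?nth_index.
rewrite big_map; apply: eq_big_seq => a a_s; congr (linform _ ^+ _).
have lt := a_s; rewrite -index_mem in lt.
rewrite -{2}(nth_index 0 a_s) -(nth_map _ (hyp 0)) // index_uniq ?size_map //.
by rewrite nth_index.
Qed.

Lemma perm_defining_polynomial n (A B : seq {vspace 'rV[K]_n}) m Q :
  perm_eq A B -> defining_polynomial B m Q -> defining_polynomial A m Q.
Proof.
move=> AB [al [alB ->]]; exists al; split; last by rewrite (perm_big _ AB).
by move=> H; rewrite (perm_mem AB); apply: alB.
Qed.

Lemma incl0E r (v : 'rV[K]_r) : incl0 K r v = row_mx (0 : 'M_(1,1)) v.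
Proof.
by have := mul_mx_row v (0 : 'M_(r, 1)) 1%:M; rewrite mulmx0 mulmx1 /incl0 lfunE.
Qed.

Lemma lker_incl0 r : lker (incl0 K r) == 0%VS.
Proof.
by apply/lker0P => u v; rewrite !incl0E => /(@eq_row_mx K 1 1 r) [].
Qed.

Lemma mem_hyp_row r (u a : 'rV[K]_1) (v b : 'rV[K]_r) :
  (row_mx u v \in hyp (row_mx a b)) = (u *m a^T + v *m b^T == 0).
Proof. by rewrite mem_hyp tr_row_mx mul_row_col. Qed.

Lemma xvec0_row r : xvec K r.+1 0 = row_mx (1%:M : 'M_1) (0 : 'rV_r).
Proof.
apply/rowP => j; rewrite !mxE; case: (@splitP 1 r j) => k ->.
  by rewrite !ord1 !mxE eqxx.
by rewrite mxE.
Qed.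

Lemma limg_incl0 r : limg (incl0 K r) = H0 K r.
Proof.
rewrite /H0 xvec0_row; apply/vspaceP => v.
have -> : v = row_mx (lsubmx (v : 'rV_(1 + r))) (rsubmx (v : 'rV_(1 + r))).
  by rewrite hsubmxK.
rewrite (mem_hyp_row (lsubmx (v : 'rV_(1 + r)))) trmx1 mulmx1 trmx0 mulmx0 addr0.
apply/memv_imgP/eqP => [[u _]|->].
  by rewrite incl0E => /(@eq_row_mx K 1 1 r) [].
by exists (rsubmx (v : 'rV_(1 + r))); rewrite ?memvf ?incl0E.
Qed.

Lemma preim_hyp r (a : 'rV[K]_r.+1) :
  (incl0 K r @^-1: (hyp a :&: H0 K r))%VS = hyp (rsubmx (a : 'rV_(1 + r))).
Proof.
rewrite -limg_incl0 lpreim_cap_limg; apply/vspaceP => v.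
rewrite -memv_preim incl0E.
have -> : a = row_mx (lsubmx (a : 'rV_(1 + r))) (rsubmx (a : 'rV_(1 + r))).
  by rewrite hsubmxK.
have := mem_hyp_row 0 (lsubmx (a : 'rV_(1 + r))) v (rsubmx (a : 'rV_(1 + r))).
by rewrite mul0mx add0r row_mxKr => ->; rewrite mem_hyp.
Qed.

(* The forms of [ArtH0]: see [ArtH0_perm]. *)
Definition ArtH0_forms (r : nat) (t : K) : seq 'rV[K]_r :=
  let x := @xvec K r in
  [seq x i | i <- iota 0 r] ++ [seq x i - x i.+1 | i <- iota 0 r.-1]
  ++ [:: x r.-1 - t *: x 0%N].


Definition form_supp n (a : 'rV[K]_n) (i : nat) : bool :=
  if insub i is Some j then a 0 (j : 'I_n) != 0 else false.

Lemma sup_neq0 n (a : 'rV[K]_n) i : form_supp a i -> a != 0.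
Proof.
rewrite /form_supp; case: insubP => // j _ _; apply: contraNneq => ->.
by rewrite mxE.
Qed.

Lemma sup_hyp n (a b : 'rV[K]_n) i k :
  form_supp b k -> form_supp a i != form_supp b i -> hyp a != hyp b.
Proof.
move=> /sup_neq0 b0; have [->|a0] := eqVneq a 0.
  move=> _; apply: contraNneq b0 => E; apply/eqP/rowP => j.
  pose d : 'rV[K]_n := delta_mx 0 j.
  have : d \in hyp (0 : 'rV[K]_n) by rewrite mem_hyp trmx0 mulmx0.
  rewrite E mem_hyp -rowE => /eqP/rowP/(_ 0).
  by rewrite !mxE.
apply: contraNneq => ab; rewrite /form_supp; case: insubP => // j _ _.
by rewrite (hyp_supp ab).
Qed.

Lemma sup_x n i k : (i < n)%N -> form_supp (xvec K n i) k = (k == i).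
Proof.
move=> lt; rewrite /form_supp; case: insubP => [j _ <-|]; rewrite ?mxE.
  by case: (eqVneq (val j) i); rewrite ?oner_eq0 ?eqxx.
by move=> kn; apply/esym/negbTE; apply: contraNneq kn => ->.
Qed.

Lemma sup_xZ n (c : K) i j k : c != 0 -> (i < n)%N -> (j < n)%N -> i != j ->
  form_supp (xvec K n i + c *: xvec K n j) k = (k == i) || (k == j).
Proof.
move=> c0 li lj ij; rewrite /form_supp; case: insubP => [l _ /= <-|]; rewrite ?mxE.
  case: (eqVneq (nat_of_ord l) i) => [->|_].
    by rewrite (negbTE ij) mulr0 addr0 oner_eq0.
  by case: (eqVneq (nat_of_ord l) j); rewrite /= ?mulr0n ?mulr1 ?mulr0 add0r ?c0 ?eqxx.
by move=> nk; apply/esym/negbTE; rewrite negb_or; apply/andP; split;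
  apply: contraNneq nk => ->.
Qed.

Lemma sup_xB n (c : K) i j k : c != 0 -> (i < n)%N -> (j < n)%N -> i != j ->
  form_supp (xvec K n i - c *: xvec K n j) k = (k == i) || (k == j).
Proof. by move=> c0; rewrite -scaleNr; apply: sup_xZ; rewrite oppr_eq0. Qed.

Lemma sup_xB1 n i j k : (i < n)%N -> (j < n)%N -> i != j ->
  form_supp (xvec K n i - xvec K n j) k = (k == i) || (k == j).
Proof. by rewrite -scaleN1r; apply: sup_xZ; rewrite oppr_eq0 oner_eq0. Qed.

Lemma sup_xD1 n i j k : (i < n)%N -> (j < n)%N -> i != j ->
  form_supp (xvec K n i + xvec K n j) k = (k == i) || (k == j).
Proof. by rewrite -{1}[xvec K n j]scale1r; apply: sup_xZ; rewrite oner_eq0. Qed.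

Lemma uniq_hyp_cat n (s1 s2 : seq 'rV[K]_n) :
    uniq [seq hyp a | a <- s1] -> uniq [seq hyp a | a <- s2] ->
    (forall a b, a \in s1 -> b \in s2 -> hyp a != hyp b) ->
  uniq [seq hyp a | a <- s1 ++ s2].
Proof.
move=> u1 u2 d; rewrite map_cat cat_uniq u1 u2 andbT; apply/hasPn => H.
by case/mapP=> b bs ->; apply/negP => /mapP[a /d /(_ bs)/eqP E] /esym.
Qed.

Lemma uniq_hyp_map n (f : nat -> 'rV[K]_n) m p :
    (forall i j, (m <= i)%N -> (j < m + p)%N -> (i < j)%N ->
       hyp (f i) != hyp (f j)) ->
  uniq [seq hyp a | a <- [seq f i | i <- iota m p]].
Proof.
move=> d; rewrite -map_comp map_inj_in_uniq ?iota_uniq // => i j.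
rewrite !mem_iota => /andP[mi ip] /andP[mj jp] /= /eqP E.
case: (ltngtP i j) => // [/(d _ _ mi jp)|/(d _ _ mj ip)]; first by rewrite E.
by rewrite eq_sym E.
Qed.

Section Art.
Variables (r : nat) (t : K).
Hypotheses (charK : [pchar K] =i pred0) (r3 : (3 <= r)%N) (t0 : t != 0).

Lemma two_neq0 : (2%:R : K) != 0.
Proof. by have := charK 2; rewrite !inE /= => /negbT. Qed.

Ltac sups := rewrite ?sup_x ?sup_xB1 ?sup_xD1 ?sup_xB //; lia.

Lemma ArtH0_forms_uniq : uniq [seq hyp a | a <- ArtH0_forms r t].
Proof.
apply: uniq_hyp_cat.
- by apply: uniq_hyp_map => i j *; apply: (@sup_hyp _ _ _ j j); sups.
- apply: uniq_hyp_cat => //.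
    by apply: uniq_hyp_map => i j *; apply: (@sup_hyp _ _ _ j.+1 j); sups.
  move=> _ _ /mapP[i ir ->] /[!inE]/eqP ->; rewrite mem_iota in ir.
  by have [E|E] := eqVneq i 0%N;
    [apply: (@sup_hyp _ _ _ 1 0) | apply: (@sup_hyp _ _ _ 0 0)]; sups.
move=> _ b /mapP[i ir ->]; rewrite mem_iota in ir.
rewrite mem_cat => /orP[/mapP[j]|]; rewrite ?mem_iota ?inE.
  move=> jr ->; have [E|E] := eqVneq i j.
    by apply: (@sup_hyp _ _ _ j.+1 j.+1); sups.
  by apply: (@sup_hyp _ _ _ j j); sups.
move/eqP->; have [E|E] := eqVneq i 0%N.
  by apply: (@sup_hyp _ _ _ r.-1 0); sups.
by apply: (@sup_hyp _ _ _ 0 0); sups.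
Qed.

Lemma Art_uniq : uniq (Art r t).
Proof.
rewrite /Art /Art_forms -cat1s; apply: uniq_hyp_cat => //; last first.
  move=> _ b /[!inE]/eqP -> /[!mem_cat] /or4P[/mapP[i]|/mapP[i]|/mapP[i]|].
  - by rewrite mem_iota => ir ->; apply: (@sup_hyp _ _ _ i i); sups.
  - by rewrite mem_iota => ir ->; apply: (@sup_hyp _ _ _ i i); sups.
  - by rewrite mem_iota => ir ->; apply: (@sup_hyp _ _ _ i i); sups.
  by rewrite inE => /eqP ->; apply: (@sup_hyp _ _ _ 1 1); sups.
apply: uniq_hyp_cat.
- by apply: uniq_hyp_map => i j *; apply: (@sup_hyp _ _ _ j j); sups.
- apply: uniq_hyp_cat.
  + by apply: uniq_hyp_map => i j *; apply: (@sup_hyp _ _ _ j j); sups.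
  + apply: uniq_hyp_cat => //.
      by apply: uniq_hyp_map => i j *; apply: (@sup_hyp _ _ _ j.+1 j); sups.
    move=> _ _ /mapP[i ir ->] /[!inE]/eqP ->; rewrite mem_iota in ir.
    by have [E|E] := eqVneq i 1%N;
      [apply: (@sup_hyp _ _ _ 2 1) | apply: (@sup_hyp _ _ _ 1 1)]; sups.
  move=> _ b /mapP[i ir ->]; rewrite mem_iota in ir.
  rewrite mem_cat => /orP[/mapP[j]|]; rewrite ?mem_iota ?inE.
    by move=> jr ->; apply: (@sup_hyp _ _ _ 0 j); sups.
  by move/eqP->; apply: (@sup_hyp _ _ _ 0 1); sups.
move=> _ b /mapP[i ir ->]; rewrite mem_iota in ir.
rewrite !mem_cat => /or3P[/mapP[j]|/mapP[j]|]; rewrite ?mem_iota ?inE.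
- move=> jr ->; have [<-|E] := eqVneq i j; last first.
    by apply: (@sup_hyp _ _ _ j j); sups.
  have ir' : (i < r.+1)%N by lia.
  apply/eqP => /hyp_minor /(_ 0 (Ordinal ir')); rewrite !mxE /=.
  have -> : (i == 0)%N = false by lia.
  have -> : (0 == i)%N = false by lia.
  rewrite eqxx !add0r addr0 subr0 mulN1r mulr1 => /eqP.
  by rewrite eq_sym -subr_eq0 opprK (negbTE two_neq0).
- by move=> jr ->; apply: (@sup_hyp _ _ _ 0 j); sups.
by move/eqP->; apply: (@sup_hyp _ _ _ 0 1); sups.
Qed.


(* The forms other than x_0, restricted to x_0 = 0. *)
Let rest : seq 'rV[K]_r.+1 := behead (Art_forms r t).

Lemma rsub_x0 : rsubmx (xvec K r.+1 0 : 'rV_(1 + r)) = 0.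
Proof. by rewrite xvec0_row row_mxKr. Qed.

Lemma rsub_xS i : rsubmx (xvec K r.+1 i.+1 : 'rV_(1 + r)) = xvec K r i.
Proof. by apply/rowP => j; rewrite !mxE. Qed.

Lemma rsub_rest : [seq rsubmx (a : 'rV_(1 + r)) | a <- rest] =
  [seq xvec K r i | i <- iota 0 r] ++ ArtH0_forms r t.
Proof.
rewrite /rest /= !map_cat /ArtH0_forms !(iotaDl 1 0) -!map_comp /=.
congr (_ ++ (_ ++ (_ ++ _))).
- by apply: eq_map => i /=; rewrite !linearB /= rsub_x0 rsub_xS subr0.
- by apply: eq_map => i /=; rewrite !linearD /= rsub_x0 rsub_xS addr0.
- by apply: eq_map => i /=; rewrite !linearB /= !rsub_xS.
rewrite linearB linearZ /= rsub_xS.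
by have := rsub_xS r.-1; rewrite prednK ?(ltn_trans _ r3) // => ->.
Qed.

Lemma Art_filter : [seq H <- Art r t | H != H0 K r] = [seq hyp a | a <- rest].
Proof.
have := Art_uniq; rewrite /Art -[Art_forms r t]/(xvec K r.+1 0 :: rest) /=.
rewrite eqxx /= => /andP[nx _]; apply/all_filterP/allP => H Hr.
by apply: contraNneq nx => E; rewrite -[hyp (xvec _ _ _)]/(H0 K r) -E.
Qed.

Lemma ArtH0_perm : perm_eq (ArtH0 r t) [seq hyp a | a <- ArtH0_forms r t].
Proof.
apply: uniq_perm ArtH0_forms_uniq _.
  rewrite /ArtH0 /coords map_inj_in_uniq ?undup_uniq // => U W.
  rewrite !mem_undup => /mapP[U' _ ->] /mapP[W' _ ->] E.
  have := congr1 (fun X => (incl0 K r @: X)%VS) E.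
  by rewrite !lpreimK // limg_incl0 capvSr.
move=> H; rewrite /ArtH0 /coords /restriction Art_filter.
have E : [seq (incl0 K r @^-1: (hyp a :&: H0 K r))%VS | a <- rest] =
    [seq hyp a | a <- [seq xvec K r i | i <- iota 0 r] ++ ArtH0_forms r t].
  by rewrite -rsub_rest -map_comp; apply: eq_map => a; rewrite /= preim_hyp.
have -> : (H \in [seq hyp a | a <- ArtH0_forms r t]) =
    (H \in [seq (incl0 K r @^-1: (hyp a :&: H0 K r))%VS | a <- rest]).
  rewrite E /ArtH0_forms !map_cat !mem_cat.
  by case: (H \in [seq hyp a | a <- [seq xvec K r i | i <- iota 0 r]]).
apply/mapP/mapP => [[U]|[a ar ->]].
  by rewrite mem_undup -map_comp => /mapP[a ar ->] ->; exists a.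
exists (hyp a :&: H0 K r)%VS => //; rewrite mem_undup -map_comp.
by apply/mapP; exists a.
Qed.

Lemma mH0_count b : b \in ArtH0_forms r t ->
  mH0 r t (hyp b) =
    (hyp b \in [seq hyp a | a <- [seq xvec K r i | i <- iota 0 r]]).+1.
Proof.
move=> bf; rewrite /mH0 /coords_mult /ziegler.
transitivity (count_mem (hyp b)
    [seq hyp a | a <- [seq rsubmx (a : 'rV_(1 + r)) | a <- rest]]).
  rewrite -(eq_count (a1 := predI (fun H => (H :&: H0 K r)%VS == (incl0 K r @: hyp b)%VS)
     (fun H => H != H0 K r))); last by move=> H; rewrite /= andbC.
  rewrite -count_filter Art_filter -map_comp !count_map.
  apply: eq_count => a /=; rewrite -preim_hyp; apply/eqP/eqP => [->|<-].
    by apply/eqP; rewrite -(eq_limg_ker0 _ _ (lker_incl0 r)) lpreimK ?limgS ?subvf.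
  by rewrite lpreimK // limg_incl0 capvSr.
rewrite rsub_rest map_cat count_cat [X in (_ + X)%N]count_uniq_mem; last first.
  exact: ArtH0_forms_uniq.
rewrite (map_f (@hyp K r) bf) addn1 count_uniq_mem //.
by have := ArtH0_forms_uniq; rewrite map_cat cat_uniq => /and3P[].
Qed.


Lemma ArtH0_forms_neq0 : all (fun a => a != 0) (ArtH0_forms r t).
Proof.
rewrite !all_cat !all_map /= andbT; apply/and3P; split.
- by apply/allP => i; rewrite mem_iota /= => ir; apply: (@sup_neq0 _ _ i); sups.
- by apply/allP => i; rewrite mem_iota /= => ir; apply: (@sup_neq0 _ _ i); sups.
by apply: (@sup_neq0 _ _ 0); sups.
Qed.

Lemma Art_forms_neq0 : all (fun a => a != 0) (Art_forms r t).
Proof.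
rewrite /= !all_cat !all_map /= andbT; apply/and5P; split.
- by apply: (@sup_neq0 _ _ 0); sups.
- by apply/allP => i; rewrite mem_iota /= => ir; apply: (@sup_neq0 _ _ 0); sups.
- by apply/allP => i; rewrite mem_iota /= => ir; apply: (@sup_neq0 _ _ 0); sups.
- by apply/allP => i; rewrite mem_iota /= => ir; apply: (@sup_neq0 _ _ i); sups.
by apply: (@sup_neq0 _ _ 1); sups.
Qed.

Lemma Art_defining_polynomial :
  let x i := linform (xvec K r.+1 i) in
  defining_polynomial (Art r t) simple
    (x 0%N * \prod_(1 <= i < r.+1) (x i ^+ 2 - x 0%N ^+ 2)
     * \prod_(1 <= i < r) (x i - x i.+1) * (x r - t *: x 1%N)).
Proof.
move=> x; have := hyp_defining_polynomial simple Art_forms_neq0 Art_uniq.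
congr (defining_polynomial _ _); rewrite (eq_bigr (@linform K _)) => [|? _].
  rewrite big_cons !big_cat !big_map big_seq1 /= linformB linformZ !mulrA.
  congr (_ * _ * _); last first.
    by rewrite /index_iota subn1; apply: eq_bigr => i _; rewrite linformB.
  rewrite -mulrA -big_split /index_iota subn1; congr (_ * _).
  by apply: eq_bigr => i _; rewrite linformB linformD subr_sqr.
exact: expr1.
Qed.

Lemma ArtH0_prod (m : {vspace 'rV[K]_r} -> nat) d :
    (forall b, b \in ArtH0_forms r t -> m (hyp b) =
      if hyp b \in [seq hyp a | a <- [seq xvec K r i | i <- iota 0 r]]
      then d else 1%N) ->
  let x i := linform (xvec K r i) in
  defining_polynomial (ArtH0 r t) m
    ((\prod_(0 <= i < r) x i ^+ d) * \prod_(0 <= i < r.-1) (x i - x i.+1)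
     * (x r.-1 - t *: x 0%N)).
Proof.
move=> Em x; apply: perm_defining_polynomial ArtH0_perm _.
have := hyp_defining_polynomial m ArtH0_forms_neq0 ArtH0_forms_uniq.
congr (defining_polynomial _ _).
have := ArtH0_forms_uniq; rewrite map_cat cat_uniq => /and3P[_ /hasPn dis _].
have m1 b : b \in [seq xvec K r i - xvec K r i.+1 | i <- iota 0 r.-1] ++
    [:: xvec K r r.-1 - t *: xvec K r 0] -> m (hyp b) = 1%N.
  move=> bs; rewrite Em ?(negbTE (dis _ (map_f (@hyp K r) bs))) //.
  by rewrite /ArtH0_forms mem_cat bs orbT.
have md b : b \in [seq xvec K r i | i <- iota 0 r] -> m (hyp b) = d.
  by move=> bs; rewrite Em ?map_f // /ArtH0_forms mem_cat bs.
rewrite big_cat /= -mulrA; congr (_ * _).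
  rewrite (eq_big_seq (fun a => linform a ^+ d)) => [|b /md -> //].
  by rewrite big_map /index_iota subn0.
rewrite (eq_big_seq (@linform K r)) => [|b /m1 -> //].
rewrite big_cat big_map big_seq1 /= linformB linformZ /index_iota subn0.
by congr (_ * _); apply: eq_bigr => i _; rewrite linformB.
Qed.

Lemma ArtH0_defining_polynomial :
  let x i := linform (xvec K r i) in
  defining_polynomial (ArtH0 r t) simple
    ((\prod_(0 <= i < r) x i) * \prod_(0 <= i < r.-1) (x i - x i.+1)
     * (x r.-1 - t *: x 0%N)).
Proof.
by apply: (@ArtH0_prod simple 1) => b _; case: ifP.
Qed.

Lemma mH0_defining_polynomial :
  let x i := linform (xvec K r i) in
  defining_polynomial (ArtH0 r t) (mH0 r t)
    ((\prod_(0 <= i < r) x i ^+ 2) * \prod_(0 <= i < r.-1) (x i - x i.+1)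
     * (x r.-1 - t *: x 0%N)).
Proof.
by apply: (@ArtH0_prod _ 2) => b /mH0_count ->; case: (_ \in _).
Qed.

End Art.
End Facts.

(* Main.v *)
Require Import Defs.
From HB Require Import structures.
From mathcomp Require Import all_boot all_order all_algebra zify ring.
From mathcomp.multinomials Require Import freeg.
Import GRing.Theory.
Local Open Scope ring_scope.

Set Implicit Arguments.
Unset Strict Implicit.
Unset Printing Implicit Defensive.

(** Write l_i = x_i - x_(i+1) for the consecutive differences and
ell = x_r - t x_1.  Every part of the theorem starts from the same change of
unknowns.  A derivation theta of the arrangement has coefficients divisible by
weights w_i, namely w_i = x_i for the restriction, w_i = x_i^2 for its Ziegler
multiplicity, and w_i = x_i^2 - x_0^2 for A_(r,t) after a multiple of the Euler
derivation has been subtracted.  If theta_i = w_i f_i, then, the l_i being prime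
and w_i = w_(i+1) modulo l_i, the condition theta_i = theta_(i+1) modulo l_i
becomes l_i | f_i - f_(i+1), that is, f_k = f_1 - sum_(i < k) l_i g_i for a free
choice of f_1 and the g_i.  Only the last condition, modulo ell, distinguishes
the three cases.

- For the weights x_i^2 it reads ell | t f_r - f_1.  Writing the quotient as h,
  it is linear in f_1 with the invertible coefficient t - 1, so f_1 is eliminated
  and the g_i and h are free parameters ([cyclicP], [ziegler_free]).  For A_(r,t)
  with t = -1 the weights agree modulo ell and the same elimination applies
  ([Art_free]).

- For A_(r,t) with t other than -1, w_r and t w_1 are distinct modulo ell.
  Substituting the points (Y, X, ..., X, tX, ..., tX) into the last condition
  shows that f_1 and all the g_i vanish at the origin ([origin_vanish]).  Hence
  the value of s (the coefficient of the Euler derivation) and the derivatives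
  of f_1 and the g_i at the origin are functionals which vanish on products of
  a polynomial without constant term and a member of the module.  They separate
  r + 2 explicit members, so that r + 2 generators at least are needed, whereas
  a free submodule of S^(r+1) has at most r + 1 of them ([Art_not_free]).

- For the weights x_i it reads ell | f_r - f_1, that is, the g_i and the
  quotient form a syzygy of l_1, ..., l_(r-1), ell, while f_1 is free.  As t is
  not 1, these r forms are a basis of the linear forms ([forms_basis]), so the
  module is S theta_E plus the first syzygies of the variables, which the Koszul
  complex resolves from its second term on ([ArtH0_min_resolution]).  Regularity
  and projective dimension are read off; the lower bound for the latter,
  against arbitrary projective resolutions, compares the minimal resolution with
  itself through the other one ([comparison_homotopy]). *)

(** * Evaluation of polynomials and divisibility by linear forms *)

Definition dvd (R : comNzRingType) (a b : R) : Prop := exists q, b = q * a.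

Lemma dvdD (R : comNzRingType) (a b c : R) : dvd a b -> dvd a c -> dvd a (b + c).
Proof. by move=> [p ->] [q ->]; exists (p + q); rewrite mulrDl. Qed.

Lemma dvdMr (R : comNzRingType) (a b c : R) : dvd a b -> dvd a (c * b).
Proof. by move=> [p ->]; exists (c * p); rewrite mulrA. Qed.

Section Variables.
Variables (K : fieldType) (n : nat).
Local Notation S := {mpoly K[n]}.
Local Notation X i := (linform (xvec K n i)).

Lemma linform_ord i (lt : (i < n)%N) : X i = 'X_(Ordinal lt).
Proof. exact: (linform_xvec K (Ordinal lt)). Qed.

(** The morphism is only specified by its values and not unfolded later: the
conversion test on two distinct evaluations would otherwise expand both. *)
Fact ev_spec (R : comNzRingType) (phi : {rmorphism K -> R}) (H : nat -> R) :
  {f : {rmorphism S -> R} | (forall c, f c%:MP = phi c) /\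
                            forall i, (i < n)%N -> f (X i) = H i}.
Proof.
exists (mmap phi (fun j : 'I_n => H j) : {rmorphism S -> R}); split=> [c|i lt].
  exact: mmapC.
by rewrite (linform_ord lt) /= mmapX mmap1U.
Qed.

Definition ev (R : comNzRingType) (phi : {rmorphism K -> R}) (H : nat -> R) :
  {rmorphism S -> R} := sval (ev_spec phi H).

Lemma evC (R : comNzRingType) (phi : {rmorphism K -> R}) H c :
  ev phi H c%:MP = phi c.
Proof. by case: (svalP (ev_spec phi H)). Qed.

Lemma evX (R : comNzRingType) (phi : {rmorphism K -> R}) H i :
  (i < n)%N -> ev phi H (X i) = H i.
Proof. by move: i; case: (svalP (ev_spec phi H)). Qed.

Lemma mpoly_alg_ind (P : S -> Prop) :
  (forall c, P c%:MP) -> (forall i, (i < n)%N -> P (X i)) ->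
  (forall p q, P p -> P q -> P (p + q)) ->
  (forall p q, P p -> P q -> P (p * q)) -> forall p, P p.
Proof.
move=> PC PX PD PM; have PC1 : P 1 := PC 1.
elim/mpolyind => [|c m p _ _ Pp]; first exact: (PC 0).
apply: PD Pp; rewrite -mul_mpolyC; apply: (PM) => //; rewrite mpolyXE_id.
apply: (big_ind P PC1 PM) => i _; elim: (m i) => [|k IH]; first by rewrite expr0.
by rewrite exprS; apply: (PM) IH; rewrite -linform_xvec; apply: PX.
Qed.

Definition endo (H : nat -> S) : {rmorphism S -> S} := ev (@mpolyC n K) H.

Lemma endoX H i : (i < n)%N -> endo H (X i) = H i.
Proof. exact: evX. Qed.

Lemma endoC H c : endo H c%:MP = c%:MP.
Proof. exact: evC. Qed.

(** The polynomials congruent to their image modulo [l] are closed under sums and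
products, so that it suffices to look at the variables. *)
Lemma endo_dvd H l : (forall i, (i < n)%N -> dvd l (X i - H i)) ->
  forall f, dvd l (f - endo H f).
Proof.
move=> lH f; elim/mpoly_alg_ind: f => [c|i lt|p q Pp Pq|p q Pp Pq].
- by exists 0; rewrite endoC subrr mul0r.
- by rewrite endoX; auto.
- by rewrite rmorphD opprD addrACA; apply: dvdD.
rewrite rmorphM /=.
have -> : p * q - endo H p * endo H q =
   q * (p - endo H p) + endo H p * (q - endo H q) by ring.
by apply: dvdD; apply: dvdMr.
Qed.

Definition subst i u : {rmorphism S -> S} :=
  endo (fun j => if j == i then u else X j).

Lemma substX i u j : (j < n)%N -> subst i u (X j) = if j == i then u else X j.
Proof. exact: endoX. Qed.

Lemma subst_dvd i u f : dvd (X i - u) (f - subst i u f).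
Proof.
apply: endo_dvd => j _; case: eqP => [->|_]; first by exists 1; rewrite mul1r.
by exists 0; rewrite subrr mul0r.
Qed.

(** Modulo [X i - u] a polynomial equals its substitution, and the substitution
kills [X i - u] because [u] is a fixed point: the ideal is the kernel of a
morphism to a domain. *)
Lemma dvd_substP i u f : (i < n)%N -> subst i u u = u ->
  dvd (X i - u) f <-> subst i u f = 0.
Proof.
move=> lt uu; split=> [[q ->]|E].
  by rewrite rmorphM rmorphB /= substX // eqxx uu subrr mulr0.
by have := subst_dvd i u f; rewrite E subr0.
Qed.

Lemma linear_form_prime i u f g : (i < n)%N -> subst i u u = u ->
  dvd (X i - u) (f * g) -> ~ dvd (X i - u) f -> dvd (X i - u) g.
Proof.
move=> lt uu /(dvd_substP _ lt uu); rewrite rmorphM => /eqP; rewrite mulf_eq0.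
by case/orP=> /eqP /(dvd_substP _ lt uu).
Qed.

Lemma mcoeff0_mul (f g : S) : (f * g)@_0%MM = f@_0%MM * g@_0%MM.
Proof. exact: (rmorphM (mcoeff 0%MM)). Qed.

End Variables.

Arguments ev {K n R} phi H.

(** * Free modules *)

Section FreeParam.
Variables (R : nzRingType) (V : lmodType R) (M : V -> Prop) (N : nat).
Variable Phi : (nat -> R) -> V.
Hypothesis Phi_lin : forall a g h, Phi (fun k => a * g k + h k) = a *: Phi g + Phi h.
Hypothesis Phi_ext : forall g h, (forall k, (k < N)%N -> g k = h k) -> Phi g = Phi h.
Hypothesis Phi_onto : forall x, M x <-> exists g, x = Phi g.
Hypothesis Phi_inj : forall g, Phi g = 0 -> forall k, (k < N)%N -> g k = 0.

(** The parameters are sequences of which only the first [N] terms matter, which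
avoids ordinals; the images of the unit sequences form the basis. *)
Lemma free_of_parametrization : is_free M.
Proof.
pose phi k := Phi (fun j => (j == k)%:R).
have Phi0 h : (forall k, (k < N)%N -> h k = 0) -> Phi h = 0.
  move=> h0; have /= := Phi_lin (-1) h h; rewrite scaleN1r addNr => <-.
  by apply: Phi_ext => k lt; rewrite h0 // mulr0 addr0.
have PhiE g : Phi g = \sum_(k <- iota 0 N) g k *: phi k.
  transitivity (Phi (fun j => \sum_(k <- iota 0 N) g k * (j == k)%:R)).
    apply: Phi_ext => k lt; rewrite (bigD1_seq k) ?iota_uniq ?mem_iota //=.
    rewrite eqxx mulr1 big1 ?addr0 // => j; rewrite eq_sym => /negbTE ->.
    by rewrite mulr0.
  elim: (iota 0 N) => [|k s IH].
    by rewrite big_nil; apply: Phi0 => k _; rewrite big_nil.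
  rewrite big_cons -IH -Phi_lin; apply: Phi_ext => j _.
  by rewrite big_cons.
have phi_inj : {in iota 0 N &, injective phi}.
  move=> i j; rewrite !mem_iota /= => ltj lti E.
  have /Phi_inj/(_ i ltj) /eqP : Phi (fun k => -1 * (k == j)%:R + (k == i)%:R) = 0.
    by rewrite Phi_lin scaleN1r -/(phi i) -/(phi j) E addNr.
  rewrite eqxx mulN1r addrC subr_eq0; case: (i =P j) => // _.
  by rewrite oner_eq0.
pose s := [seq phi k | k <- iota 0 N].
have us : uniq s by rewrite map_inj_in_uniq ?iota_uniq.
exists (fun v => v \in s); split=> [b /mapP[k _ ->]|x /Phi_onto[g ->]|s' c us' s's].
- by apply/Phi_onto; exists (fun j => (j == k)%:R).
- exists s, (fun v => g (index v s)); split=> //.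
  rewrite PhiE big_map; apply: eq_big_seq => k; rewrite mem_iota /= => lt.
  have -> : phi k = nth 0 s k by rewrite (nth_map 0%N) ?size_iota // nth_iota.
  by rewrite index_uniq // size_map size_iota.
move=> E b bs'; have /mapP[k kN Eb] := s's b bs'.
pose c' k := if phi k \in s' then c (phi k) else 0.
have /Phi_inj/(_ k) : Phi c' = 0.
  rewrite PhiE -[RHS]E.
  transitivity (\sum_(k <- iota 0 N | phi k \in s') c (phi k) *: phi k).
    rewrite [RHS]big_mkcond; apply: eq_bigr => j _.
    by rewrite /c'; case: ifP; rewrite ?scale0r.
  rewrite -(big_map phi (mem s') (fun b => c b *: b)) -big_filter.
  apply: perm_big; apply: uniq_perm => // [|v]; first exact: filter_uniq.
  by rewrite mem_filter; apply/andP/idP => [[]|vs'] //; split=> //; apply: s's.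
by rewrite /c' -Eb bs'; rewrite mem_iota in kN; apply.
Qed.

End FreeParam.

Section Rank.
Variable D : idomainType.

Import FracField.

Lemma frac_denom (x : {fraction D}) :
  exists a b : D, b != 0 /\ tofrac b * x = tofrac a.
Proof.
elim/quotW: x => y; exists (\n_y), (\d_y); split; first exact: denom_ratioP.
unlock tofrac; rewrite -[LHS]pi_mul; apply/eqmodP.
by rewrite /= equivfE /mulf /= !numden_Ratio ?oner_eq0 // ?mul1r ?mulr1 ?denom_ratioP // mulrC.
Qed.

(** A relation over the field of fractions exists by rank; multiply by the
denominators. *)
Lemma row_dependent k n (A : 'M[D]_(k, n)) : (n < k)%N ->
  exists u : 'rV[D]_k, u != 0 /\ u *m A = 0.
Proof.
move=> nk; pose B := map_mx (@tofrac D) A.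
have /rowV0Pn[v /sub_kermxP vB v0] : kermx B != 0.
  rewrite -mxrank_eq0 mxrank_ker -lt0n subn_gt0.
  exact: leq_ltn_trans (rank_leq_col _) nk.
have [a /fin_all_exists[b ab]] := fin_all_exists (fun i => frac_denom (v 0 i)).
pose d := \prod_i b i.
have d0 : d != 0 by apply/prodf_neq0 => i _; case: (ab i).
have cl i : exists w, tofrac w = tofrac d * v 0 i.
  exists ((\prod_(j | j != i) b j) * a i).
  have -> : d = b i * \prod_(j | j != i) b j by rewrite /d (bigD1 i).
  by rewrite !tofracM -(ab i).2; ring.
have [w wE] := fin_all_exists cl.
exists (\row_i w i); split.
  apply: contraNneq v0 => /rowP w0; apply/eqP/rowP => i; rewrite mxE.
  have := wE i; have := w0 i; rewrite !mxE => ->; rewrite tofrac0 => /esym/eqP.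
  by rewrite mulf_eq0 tofrac_eq0 (negbTE d0) => /eqP.
apply/rowP => j; apply/eqP; rewrite mxE [X in _ == X]mxE -tofrac_eq0 rmorph_sum /=.
have := congr1 (fun z : 'rV_n => tofrac d * z 0 j) vB; rewrite !mxE mulr0 mulr_sumr => E.
by apply/eqP; rewrite -[RHS]E; apply: eq_bigr => i _; rewrite rmorphM !mxE /= wE mulrA.
Qed.

(** Finitely many members of a free submodule involve finitely many members of
its basis, and at most [n] of these since they are independent in [D^n].  The
basis itself may be infinite as far as the definition goes, so the bound is on
the part of it that is used. *)
Lemma free_generators n (M : 'rV[D]_n -> Prop) m (e : 'I_m -> 'rV[D]_n) :
    is_free M -> (forall j, M (e j)) ->
  exists k (b : 'I_k -> 'rV[D]_n) (a : 'M[D]_(m, k)),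
    [/\ (k <= n)%N, forall i, M (b i) & forall j, e j = \sum_i a j i *: b i].
Proof.
move=> [B [BM Bspan Bind]] eM.
pose span (t : seq 'rV[D]_n) x := exists c : 'rV[D]_n -> D, x = \sum_(b <- t) c b *: b.
have [s sc] := fin_all_exists (fun j => Bspan _ (eM j)).
pose t := undup (flatten [seq s j | j <- enum 'I_m]).
have tB : {in t, forall b, B b}.
  move=> b; rewrite mem_undup => /flattenP[_ /mapP[j _ ->] bs].
  by have [c [sB _]] := sc j; apply: sB.
have ut : uniq t by apply: undup_uniq.
have spant j : span t (e j).
  have [c [sB ->]] := sc j.
  have st : {subset s j <= t}.
    by move=> b bs; rewrite mem_undup; apply/flattenP; exists (s j); rewrite ?map_f ?mem_enum.
  elim: (s j) st => [|b s' IH] st.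
    by exists (fun=> 0); rewrite big_nil big1 // => b _; rewrite scale0r.
  have [|c' E] := IH; first by move=> x xs; apply: st; rewrite inE xs orbT.
  exists (fun v => c b * (v == b)%:R + c' v); rewrite big_cons E.
  have bt : b \in t by apply: st; rewrite inE eqxx.
  rewrite [in LHS](bigD1_seq b) // [in RHS](bigD1_seq b) //= eqxx mulr1 scalerDl.
  rewrite addrA; congr (_ + _); apply: eq_bigr => v /negbTE ->.
  by rewrite mulr0 add0r.
have [c tE] := fin_all_exists spant.
exists (size t), (fun i => nth 0 t i), (\matrix_(j, i) c j (nth 0 t i)); split.
- rewrite leqNgt; apply/negP => nt.
  have [u [u0 uA]] := row_dependent (\matrix_(i < size t, j < n) nth 0 t i 0 j) nt.
  case/negP: u0; apply/eqP/rowP => i; rewrite mxE.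
  pose d v := if insub (index v t) is Some i then u 0 i else 0.
  have dE (k : 'I_(size t)) : d (nth 0 t k) = u 0 k.
    by rewrite /d index_uniq // insubT //= => lt; congr (u _ _); apply: val_inj.
  rewrite -dE; apply: (Bind t) => //; last by rewrite mem_nth.
  rewrite (big_nth 0) big_mkord; apply/rowP => j.
  have := congr1 (fun z : 'rV_n => z 0 j) uA; rewrite !mxE => E.
  by rewrite summxE -[RHS]E; apply: eq_bigr => k _; rewrite dE !mxE.
- by move=> i; apply/BM/tB; rewrite mem_nth.
move=> j; rewrite tE (big_nth 0) big_mkord; apply: eq_bigr => i _.
by rewrite mxE.
Qed.

End Rank.

(** * Projective dimension of a module with a minimal resolution *)

(** Projectivity, with the surjectivity of [g] replaced by what the lifting needs:
this allows lifting through a map whose image is a submodule that has no type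
of its own. *)
Definition lifts (R : nzRingType) (P : lmodType R) : Prop :=
  forall (X Y : lmodType R) (g : {linear X -> Y}) (f : {linear P -> Y}),
    (forall p, exists x, g x = f p) ->
    exists h : {linear P -> X}, forall p, g (h p) = f p.

Section Lifting.
Variable R : nzRingType.

Lemma linear_of (U W : lmodType R) (f : U -> W) :
  linear f -> {h : {linear U -> W} | h =1 f}.
Proof.
move=> lf; pose m := GRing.isLinear.Build R U W _ f lf.
by exists (HB.pack_for {linear U -> W} f m).
Qed.

Section FreegLift.
Variables (T : choiceType) (W : lmodType R) (w : T -> W).

HB.instance Definition _ :=
  GRing.isZmodMorphism.Build {freeg T / R} W (fglift w) (lift_is_additive w).

Lemma fglift_scalable : scalable (fglift w : {freeg T / R} -> W).
Proof.
move=> a D; have E : fglift w D = \sum_(x <- dom D) coeff x D *: w x.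
  rewrite -{1}[D]freeg_sumE raddf_sum.
  by apply: eq_bigr => x _; rewrite /= liftU.
rewrite E [a *: D]/GRing.scale /= /fgscale raddf_sum scaler_sumr.
by apply: eq_bigr => x _; rewrite /= liftU scalerA.
Qed.

HB.instance Definition _ :=
  GRing.isScalable.Build R {freeg T / R} W *:%R (fglift w) fglift_scalable.

End FreegLift.

(** A projective module is a direct summand of the free module on its elements,
where lifts are chosen on the generators. *)
Lemma projective_lifts (P : lmodType R) : is_projective P -> lifts P.
Proof.
move=> projP X Y g f fg.
have gf p : exists x, g x == f p by have [x <-] := fg p; exists x.
pose pi : {linear {freeg P / R} -> P} := fglift id.
have [|s sK] := projP _ _ pi idfun.
  by move=> p; exists << p >>; rewrite /pi /= liftU scale1r.
pose l : {linear {freeg P / R} -> X} := fglift (fun p => xchoose (gf p)).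
exists (l \o s : {linear P -> X}) => p /=.
have E : p = pi (s p) by rewrite sK.
rewrite [in RHS]E -[s p]freeg_sumE !linear_sum; apply: eq_bigr => q _ /=.
by rewrite !liftU !linearZ (eqP (xchooseP (gf q))).
Qed.

Lemma ffun_basis (I : finType) (c : {ffun I -> R^o}) :
  c = \sum_i c i *: [ffun j => (j == i)%:R].
Proof.
apply/ffunP => j; rewrite sum_ffunE (bigD1 j) //= !ffunE eqxx big1 => [|i ij].
  by rewrite addr0 /GRing.scale /= mulr1.
by rewrite !ffunE eq_sym (negbTE ij) scaler0.
Qed.

Lemma linear_expand (I : finType) (W : lmodType R) (f : {ffun I -> R^o} -> W) b :
  linear f -> f b = \sum_i b i *: f [ffun j => (j == i)%:R].
Proof.
move=> /linear_of[h hE]; rewrite -hE {1}[b]ffun_basis linear_sum.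
by apply: eq_bigr => i _; rewrite linearZ /= hE.
Qed.

Lemma ffun_lifts (I : finType) : lifts {ffun I -> R^o}.
Proof.
move=> X Y g f fg; have [x xE] := fin_all_exists (fun i => fg [ffun j => (j == i)%:R]).
have [h hE] : {h : {linear {ffun I -> R^o} -> X} | h =1 fun c => \sum_i c i *: x i}.
  apply: linear_of => a u v; rewrite scaler_sumr -big_split; apply: eq_bigr => i _.
  by rewrite !ffunE scalerDl scalerA.
exists h => c; rewrite hE {2}[c]ffun_basis !linear_sum; apply: eq_bigr => i _.
by rewrite !linearZ /= xE.
Qed.

Lemma lifts_projective (P : lmodType R) : lifts P -> is_projective P.
Proof. by move=> lP X Y g f g_onto; apply: lP => p; apply: g_onto. Qed.

End Lifting.

Section Resolutions.
Variables (K : fieldType) (n m : nat).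
Local Notation S := {mpoly K[n]}.
Variables (M : 'rV[S]_m -> Prop) (C : gcomplex K n) (e : cbas C 0 -> 'rV[S]_m).

Let F i : lmodType S := {ffun cbas C i -> S^o}.

Lemma dmap_linear i : {d : {linear F i.+1 -> F i} | forall c, d c = dmap c}.
Proof.
apply: linear_of => a u v; apply/ffunP => l; rewrite !ffunE scaler_sumr -big_split.
by apply: eq_bigr => k _ /=; rewrite !ffunE mulrDl /GRing.scale /= mulrA.
Qed.

Lemma augmap_linear : {d : {linear F 0 -> 'rV[S]_m} | forall c, d c = augmap e c}.
Proof.
apply: linear_of => a u v; rewrite scaler_sumr -big_split.
by apply: eq_bigr => k _ /=; rewrite !ffunE scalerDl scalerA.
Qed.

Section LowerBound.
Hypothesis res : min_free_resolution M e.
Variables (P : nat -> lmodType S) (d : forall i, {linear P i.+1 -> P i}).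
Variable (eP : {linear P 0%N -> 'rV[S]_m}).
Hypothesis projP : forall i, is_projective (P i).
Hypothesis MeP : forall x, M x <-> exists p, x = eP p.
Hypothesis keP : forall p, eP p = 0 <-> exists q, p = d 0%N q.
Hypothesis kdP : forall i p, d i p = 0 <-> exists q, p = d i.+1 q.

Let Fcycle i : F i -> Prop :=
  match i with 0%N => fun c => augmap e c = 0 | i'.+1 => fun c => dmap c = 0 end.
Let Pcycle i : P i -> Prop :=
  match i with 0%N => fun p => eP p = 0 | i'.+1 => fun p => d i' p = 0 end.

Let FcycleP i (c : F i) : Fcycle c <-> exists b : F i.+1, c = dmap b.
Proof. by case: res => -[_ _ _ ke kd] _; case: i c => [|i] c; [apply: ke | apply: kd]. Qed.

Let PcycleP i (p : P i) : Pcycle p <-> exists q, p = d i q.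
Proof. by case: i p => [|i] p; [apply: keP | apply: kdP]. Qed.

(* The vectors with entries in the ideal of the origin. *)
Let in_max i (c : F i) : Prop := forall k, (c k : S)@_0%MM = 0.

Let linear_max i j (f : {linear F i -> F j}) c : in_max c -> in_max (f c).
Proof.
move=> cm k; rewrite [c]ffun_basis linear_sum sum_ffunE raddf_sum big1 //= => l _.
by rewrite linearZ ffunE /= /GRing.scale /= mcoeff0_mul cm mul0r.
Qed.

Let dmap_max i (c : F i.+1) : in_max (dmap c : F i).
Proof.
move=> k; rewrite ffunE raddf_sum big1 //= => l _; rewrite mcoeff0_mul.
by case: res => _ ->; rewrite mulr0.
Qed.

(** The composite [b \o a] of the two lifts of the identity of [M] between the
minimal resolution F and the resolution P is homotopic to the identity.  Only
one degree of the homotopy identity is recorded: [u] stands for the term that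
comes from the preceding degree, of which the induction needs that it vanishes
on cycles.  That its values have entries in the ideal of the origin is where
minimality enters. *)
Lemma comparison_homotopy i : exists (a : {linear F i -> P i}) (b : {linear P i -> F i})
    (u : {linear F i -> F i}) (h : {linear F i -> F i.+1}),
  [/\ forall c, Fcycle c -> Pcycle (a c), forall p, Pcycle p -> Fcycle (b p),
      forall c, Fcycle c -> u c = 0, forall c, in_max (u c)
    & forall c, c - b (a c) - u c = dmap (h c)].
Proof.
elim: i => [|i [a [b [u [h [aZ bZ uZ um E]]]]]].
  have [eF eFE] := augmap_linear.
  have Me : forall x, M x <-> exists c, x = augmap e c by case: res => -[].
  have [a aE] : exists a : {linear F 0 -> P 0%N}, forall c, eP (a c) = eF c.
    apply: ffun_lifts => c; have /MeP[p ->] : M (eF c) by apply/Me; exists c; rewrite eFE.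
    by exists p.
  have [b bE] : exists b : {linear P 0%N -> F 0}, forall p, eF (b p) = eP p.
    apply: projective_lifts => // p; have /Me[c ->] : M (eP p) by apply/MeP; exists p.
    by exists c; rewrite eFE.
  have [d0 d0E] := dmap_linear 0.
  have [h hE] : exists h : {linear F 0 -> F 1}, forall c, d0 (h c) = c - b (a c).
    pose f : {linear F 0 -> F 0} := idfun \- (b \o a).
    apply: (@ffun_lifts _ _ _ _ d0 f) => c.
    have /FcycleP[c' E] : Fcycle (c - b (a c)).
      by rewrite /Fcycle /= -eFE linearB bE aE subrr.
    by exists c'; rewrite d0E -E.
  exists a, b, \0, h; split=> //= [c|p|c k|c].
  - by rewrite -eFE -aE.
  - by rewrite -eFE bE.
  - by rewrite ffunE mcoeff0.
  by rewrite subr0 -hE d0E.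
have [dF dFE] := dmap_linear i.
have dFZ c : Fcycle (dF c) by apply/FcycleP; exists c; rewrite dFE.
have dPZ p : Pcycle (d i p) by apply/PcycleP; exists p.
have [a' aE] : exists a' : {linear F i.+1 -> P i.+1}, forall c, d i (a' c) = a (dF c).
  apply: (@ffun_lifts _ _ _ _ (d i) (a \o dF : {linear _ -> _})) => c.
  by have /aZ/PcycleP[p Ep] := dFZ c; exists p; rewrite -Ep.
have [b' bE] : exists b' : {linear P i.+1 -> F i.+1}, forall p, dF (b' p) = b (d i p).
  apply: (@projective_lifts _ _ (@projP i.+1) _ _ dF (b \o d i : {linear _ -> _})) => p.
  by have /bZ/FcycleP[c Ec] := dPZ p; exists c; rewrite dFE -Ec.
have [d1 d1E] := dmap_linear i.+1.
have [h' hE] : exists h' : {linear F i.+1 -> F i.+2},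
    forall c, d1 (h' c) = c - b' (a' c) - h (dF c).
  pose f : {linear F i.+1 -> F i.+1} := (idfun \- (b' \o a')) \- (h \o dF).
  apply: (@ffun_lifts _ _ _ _ d1 f) => c.
  have /FcycleP[c' Ec'] : Fcycle (c - b' (a' c) - h (dF c)); last first.
    by exists c'; rewrite d1E -Ec'.
  by rewrite /Fcycle -dFE !linearB bE aE [X in _ - X]dFE -E uZ // subr0 subrr.
exists a', b', (h \o dF : {linear _ -> _}), h'; split=> /= [c|p|c|c|c].
- by rewrite -dFE aE => ->; rewrite linear0.
- by rewrite -dFE bE => ->; rewrite linear0.
- by rewrite -dFE => ->; rewrite linear0.
- by apply: linear_max; rewrite dFE; apply: dmap_max.
by rewrite -hE d1E.
Qed.

(** If P ended before degree [i], then [b \o a] would be zero there, and every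
vector of F, in particular a unit vector, would have its entries in the ideal of
the origin. *)
Lemma minimal_resolution_length i N : cbas C i ->
  (forall j, (N < j)%N -> forall p : P j, p = 0) -> (i <= N)%N.
Proof.
move=> k PN; rewrite leqNgt; apply/negP => /PN P0.
have [a [b [u [h [_ _ _ um E]]]]] := comparison_homotopy i.
pose c : F i := [ffun j => (j == k)%:R].
have := E c; rewrite [a c]P0 linear0 subr0 => /ffunP/(_ k)/(congr1 (mcoeff 0%MM)).
rewrite (dmap_max (h c)) !ffunE eqxx raddfB /= (um c) subr0 mcoeff1 eqxx => /eqP.
by rewrite oner_eq0.
Qed.

End LowerBound.

Lemma min_resolution_pdim N : min_free_resolution M e ->
  cbas C N -> (forall i, (N < i)%N -> #|cbas C i| = 0%N) -> has_pdim M N.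
Proof.
move=> res k small; split; last first.
  move=> N' [P [d [eP [projP P0 MeP keP kdP]]]].
  exact: (minimal_resolution_length res projP MeP keP kdP k).
have [[_ _ Me ke kd] _] := res.
have [eF eFE] := augmap_linear.
pose d i := sval (dmap_linear i).
have dE i c : d i c = dmap c by rewrite /d; case: dmap_linear.
exists F, d, eF; split.
- by move=> i; apply/lifts_projective/ffun_lifts.
- move=> i /small C0 p; apply/ffunP => j.
  by have := fintype0 j C0.
- by move=> x; rewrite Me; split=> -[c ->]; exists c; rewrite eFE.
- by move=> p; rewrite eFE ke; split=> -[q ->]; exists q; rewrite dE.
by move=> i p; rewrite dE kd; split=> -[q ->]; exists q; rewrite dE.
Qed.

End Resolutions.

(** * Exactness of the Koszul complex *)

Section Koszul.
Variables (K : fieldType) (n : nat).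
Local Notation S := {mpoly K[n]}.
Local Notation Xv i := (linform (xvec K n i)).
Implicit Types (c : {set 'I_n} -> S) (J : {set 'I_n}) (f g a : S).

Definition ksign J (i : 'I_n) : S := (-1) ^+ #|[set j in J | (j < i)%N]|.

(** The Koszul differential on families indexed by all subsets, of any size, so
that it can be studied without subtypes. *)
Definition kdiff c J : S :=
  \sum_(i | i \notin J) ksign J i * 'X_i * c (i |: J).

Lemma ksign_min J (i : 'I_n) : (forall j, j \in J -> (i <= j)%N) -> ksign J i = 1.
Proof.
move=> min; rewrite /ksign (_ : [set _ in _ | _] = set0) ?cards0 //.
apply/setP => j; rewrite !inE; apply/negbTE/negP => /andP[/min]; lia.
Qed.

Lemma ksignU1 J (i k : 'I_n) : i \notin J ->
  ksign (i |: J) k = (-1) ^+ (i < k)%N * ksign J k.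
Proof.
move=> iJ; rewrite /ksign -exprD; congr (_ ^+ _).
rewrite (cardsD1 i) !inE eqxx /=; congr (_ + _)%N; apply: eq_card => j.
by rewrite !inE; case: eqVneq => [->|] //=; rewrite (negbTE iJ).
Qed.

(** The two orders in which i and k can be adjoined to [J] contribute opposite
coefficients. *)
Lemma kdiff_kdiff c J : kdiff (kdiff c) J = 0.
Proof.
pose F (i k : 'I_n) := if [&& i \notin J, k \notin J & i != k] then
  ksign J i * ksign (i |: J) k * ('X_i * 'X_k) * c (k |: (i |: J)) else 0.
have FN (i k : 'I_n) : (i < k)%N -> F k i = - F i k.
  move=> ik; rewrite /F andbCA eq_sym; case: ifP => [/and3P[kJ iJ _]|_]; last by rewrite oppr0.
  rewrite !ksignU1 // ik ltnNge ltnW //= expr0 expr1 mul1r setUCA.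
  by ring.
transitivity (\sum_i \sum_k F i k).
  rewrite /kdiff [LHS]big_mkcond; apply: eq_bigr => i _; rewrite /F.
  case: (i \notin J); last by rewrite big1.
  rewrite mulr_sumr big_mkcond; apply: eq_bigr => k _.
  rewrite in_setU1 negb_or andbC [k == i]eq_sym; case: ifP => // _.
  by ring.
have -> : \sum_i \sum_k F i k = \sum_(i < n) \sum_(k < n | (i < k)%N) F i k
    + \sum_(i < n) \sum_(k < n | (k < i)%N) F i k.
  rewrite -big_split; apply: eq_bigr => i _ /=.
  rewrite [in RHS]big_mkcond [X in _ = _ + X]big_mkcond -big_split.
  apply: eq_bigr => k _ /=; case: ltngtP => [||/val_inj ->]; rewrite ?addr0 ?add0r //.
  by rewrite /F eqxx !andbF.
rewrite [X in _ + X](exchange_big_dep xpredT) //= -big_split big1 //= => i _.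
by rewrite -big_split big1 //= => k ik; rewrite (FN _ _ ik) addrN.
Qed.

Definition ktail (m : nat) : {rmorphism S -> S} :=
  endo (fun j => if (j < m)%N then 0 else Xv j).

Lemma ktailX m (i : 'I_n) : ktail m 'X_i = if (i < m)%N then 0 else 'X_i.
Proof. by rewrite -linform_xvec /ktail endoX. Qed.

Lemma ktail0 f : ktail 0 f = f.
Proof.
rewrite /ktail; elim/mpoly_alg_ind: f => [c|i lt|p q Ep Eq|p q Ep Eq].
- by rewrite endoC.
- by rewrite endoX.
- by rewrite rmorphD /= Ep Eq.
by rewrite rmorphM /= Ep Eq.
Qed.

Lemma ktailS m f : ktail m.+1 f = subst m 0 (ktail m f).
Proof.
rewrite /ktail; elim/mpoly_alg_ind: f => [c|i lt|p q Ep Eq|p q Ep Eq].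
- by rewrite /subst !endoC.
- rewrite !endoX //; case: (ltngtP i m) => im; rewrite ?(ltnW im) ?rmorph0 //=.
  + by rewrite ltnS ltnW ?rmorph0.
  + by rewrite ltnS leqNgt im substX // gtn_eqF.
  by rewrite im ltnS leqnn substX // -?im // eqxx.
- by rewrite !rmorphD /= Ep Eq.
by rewrite !rmorphM /= Ep Eq.
Qed.

Lemma kdivides (m : 'I_n) f : exists q, ktail m f - ktail m.+1 f == q * 'X_m.
Proof.
have [q E] := subst_dvd m 0 (ktail m f).
by exists q; rewrite ktailS E subr0 linform_xvec.
Qed.

Fact kdiv_spec : {T : 'I_n -> S -> S |
  forall m f, T m f * 'X_m = ktail m f - ktail m.+1 f}.
Proof.
exists (fun m f => xchoose (kdivides m f)) => m f.
by rewrite -(eqP (xchooseP (kdivides m f))).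
Qed.

(** Collects the monomials of [f] whose first variable is x_m, divided by x_m. *)
Definition kdiv : 'I_n -> S -> S := sval kdiv_spec.

Lemma kdivE m f : kdiv m f * 'X_m = ktail m f - ktail m.+1 f.
Proof. exact: (svalP kdiv_spec). Qed.

Lemma mulXI (m : 'I_n) : injective (fun f : S => f * 'X_m).
Proof. by apply: mulIf; rewrite -msupp_eq0 msuppX. Qed.

Lemma kdiv_is_zmod m : zmod_morphism (kdiv m).
Proof.
move=> f g; apply: (@mulXI m); rewrite /= mulrBl !kdivE !rmorphB /= !opprB.
rewrite addrACA [X in _ + X]addrC.
by rewrite [RHS]addrACA.
Qed.
HB.instance Definition _ m := GRing.isZmodMorphism.Build S S (kdiv m) (kdiv_is_zmod m).

Lemma kdivM (m : 'I_n) a f : ktail m a = a -> ktail m.+1 a = a ->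
  kdiv m (a * f) = a * kdiv m f.
Proof.
by move=> Ea Ea'; apply: (@mulXI m); rewrite /= -mulrA !kdivE !rmorphM /= Ea Ea' mulrBr.
Qed.

Lemma kdivX (m : 'I_n) f : kdiv m ('X_m * f) = ktail m f.
Proof.
by apply: (@mulXI m); rewrite /= kdivE !rmorphM /= !ktailX ltnn ltnSn mul0r subr0 mulrC.
Qed.

Lemma kdivX_lt (m i : 'I_n) f : (i < m)%N -> kdiv m ('X_i * f) = 0.
Proof.
move=> im; apply: (@mulXI m); rewrite /= kdivE !rmorphM /= !ktailX im ltnS ltnW //.
by rewrite !mul0r subrr.
Qed.

(** The contracting homotopy that moves the first variable of x^a e_I to the
exterior factor if it precedes all of [I]; read on coefficients, at [J] it
divides by the variable of the least element of [J]. *)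
Definition khomotopy c J : S :=
  if [pick m in J | [forall j in J, (m <= j)%N]] is Some m
  then kdiv m (c (J :\ m)) else 0.

Lemma khomotopyE c J m : m \in J -> (forall j, j \in J -> (m <= j)%N) ->
  khomotopy c J = kdiv m (c (J :\ m)).
Proof.
move=> mJ minm; rewrite /khomotopy; case: pickP => [k /andP[kJ /forall_inP mink]|].
  by have -> : k = m by apply: val_inj; apply: anti_leq => /=; rewrite mink ?minm.
by move/(_ m); rewrite /= mJ => /negbT/negP[]; apply/forall_inP.
Qed.

(** At [J] with least element m: the terms of [kdiff] that add an index i < m give
the telescoping sum of the [ktail i (c J) - ktail i.+1 (c J)], that is,
[c J - ktail m (c J)]; the missing [ktail m (c J)] is the term of the other
summand that adds m back, and the terms with i > m cancel since passing over m
changes the sign. *)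
Lemma koszul_homotopy c J : J != set0 ->
  kdiff (khomotopy c) J + khomotopy (kdiff c) J = c J.
Proof.
case/set0Pn => i0 i0J.
pose m := [arg min_(i < i0 in J) val i].
have [mJ minm] : m \in J /\ forall j, j \in J -> (m <= j)%N.
  by rewrite /m; case: arg_minnP.
rewrite (khomotopyE _ mJ minm) /kdiff raddf_sum /=.
have mJ' : m \notin J :\ m by rewrite !inE eqxx.
rewrite [X in _ + X](bigD1 m) //= ksign_min; last first.
  by move=> j; rewrite inE => /andP[_ /minm].
rewrite mul1r kdivX setD1K //.
rewrite [X in X + _](bigID (fun i : 'I_n => (i < m)%N)) /=.
have -> : \sum_(i | (i \notin J) && (i < m)%N)
    ksign J i * 'X_i * khomotopy c (i |: J) = c J - ktail m (c J).
  transitivity (\sum_(i < n | (i < m)%N) (ktail i (c J) - ktail i.+1 (c J))).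
    apply: eq_big => [i|i /andP[iJ im]].
      by apply: andb_idl => im; apply: contraL im => /minm; rewrite -leqNgt.
    have mini j : j \in J -> (i <= j)%N by move/minm; lia.
    rewrite ksign_min // mul1r (khomotopyE _ (m := i)) ?setU11 //; last first.
      by move=> j /setU1P[->|/mini].
    by rewrite setU1K // mulrC kdivE.
  transitivity (\sum_(0 <= i < m) (ktail i (c J) - ktail i.+1 (c J))).
    by rewrite big_mkord (big_ord_narrow (ltnW (ltn_ord m))).
  rewrite (telescope_sumr_eq (fun i => - ktail i (c J))) //=.
    by rewrite ktail0 opprK addrC.
  by move=> i _; rewrite opprK addrC.
suff -> : \sum_(i | (i \notin J) && ~~ (i < m)%N) ksign J i * 'X_i * khomotopy c (i |: J)
   = - \sum_(i | (i \notin J :\ m) && (i != m))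
         kdiv m (ksign (J :\ m) i * 'X_i * c (i |: J :\ m)).
  by ring.
rewrite -sumrN big_mkcond [RHS]big_mkcond; apply: eq_bigr => i _.
rewrite in_setD1 negb_and negbK; case: (eqVneq i m) => [->|im].
  by rewrite mJ /= ?eqxx ?andbF.
rewrite /= andbT; case iJ: (i \in J) => //=.
have sgt k : ktail k (ksign (J :\ m) i) = ksign (J :\ m) i by rewrite rmorph_sign.
rewrite -!mulrA kdivM //; case: (ltnP i m) => mi /=; first by rewrite kdivX_lt // mulr0 oppr0.
have {}mi : (m < i)%N by rewrite ltn_neqAle mi eq_sym val_eqE im.
have im0 : (i < m)%N = false by lia.
have im1 : (i < m.+1)%N = false by lia.
rewrite kdivM ?ktailX ?im0 ?im1 //.
rewrite -{1}(setD1K mJ) ksignU1 // mi expr1 mulN1r mulNr.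
congr (- (_ * (_ * _))); rewrite (khomotopyE _ (m := m)) ?inE ?mJ ?orbT //.
  by rewrite setDUl; congr (kdiv _ (c (_ :|: _))); apply/setDidPl; rewrite disjoints1 inE.
by move=> j /setU1P[->|/minm //]; apply: ltnW.
Qed.

Lemma koszul_exact c J : (forall J', kdiff c J' = 0) -> J != set0 ->
  c J = kdiff (khomotopy c) J.
Proof.
move=> c0 J0; rewrite -[LHS](koszul_homotopy _ J0).
suff -> : khomotopy (kdiff c) J = 0 by rewrite addr0.
by rewrite /khomotopy; case: pickP => // m _; rewrite c0 raddf0.
Qed.

End Koszul.

Arguments ksign {K n} J i.

(** * The Koszul complex of the variables and their syzygies *)

Section KoszulComplex.
Variables (K : fieldType) (n : nat).
Local Notation S := {mpoly K[n]}.
Local Notation koz := (koszul K n).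

Definition kext p (c : {ffun cbas koz p -> S}) (I : {set 'I_n}) : S :=
  oapp c 0 (insub I).

Lemma kextE p (c : {ffun cbas koz p -> S}) J : kext c (val J) = c J.
Proof. by rewrite /kext valK. Qed.

Lemma kext_out p (c : {ffun cbas koz p -> S}) (I : {set 'I_n}) : #|I| != p -> kext c I = 0.
Proof. by move=> Ip; rewrite /kext insubN. Qed.

Lemma kext_in p (c : {ffun cbas koz p -> S}) (I : {set 'I_n}) (Ip : #|I| == p) :
  kext c I = c (exist _ I Ip).
Proof. by rewrite /kext insubT. Qed.

Lemma dmap_koszul p (c : {ffun cbas koz p.+1 -> S}) J :
  dmap c J = kdiff (kext c) (val J).
Proof.
rewrite ffunE /kdiff.
transitivity (\sum_(I : {set 'I_n} | #|I| == p.+1)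
    \sum_(i in I | val J == I :\ i) ksign (val J) i * 'X_i * kext c I).
  rewrite (reindex_omap val (insub : _ -> option (cbas koz p.+1))) /=; last first.
    by move=> I Ip; rewrite insubT.
  apply: eq_big => [k|k _]; first by rewrite (valP k) valK eqxx.
  rewrite kextE mulr_sumr; apply: eq_bigr => i /andP[ik /eqP ->].
  rewrite mulrC; congr (_ ^+ _ * _ * _); apply: eq_card => j.
  by rewrite !inE; case: eqVneq => [->|//]; rewrite ltnn andbF.
rewrite (exchange_big_dep (fun i => i \notin val J)) /=; last first.
  by move=> I i _ /andP[_ /eqP ->]; rewrite !inE eqxx.
apply: eq_bigr => i iJ; rewrite (big_pred1 (i |: val J)) // => I /=.
apply/andP/eqP => [[_ /andP[iI /eqP ->]]|->]; first by rewrite setD1K.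
by rewrite setU11 setU1K // eqxx cardsU1 iJ (eqP (valP J)).
Qed.

Lemma dmap_dmap_koszul p (b : {ffun cbas koz p.+2 -> S}) : dmap (dmap b) = 0.
Proof.
apply/ffunP => J; rewrite dmap_koszul ffunE -(kdiff_kdiff (kext b) (val J)).
apply: eq_bigr => i iJ; congr (_ * _).
have ip : #|i |: val J| == p.+1 by rewrite cardsU1 iJ (eqP (valP J)).
by rewrite (kext_in _ ip) dmap_koszul.
Qed.

(** The extension by zero of a cycle is a cycle of the total complex, so the
homotopy applies; [kdiff] at [J] only sees subsets with one more element, hence
the sizes may be cut off again. *)
Lemma koszul_cycle p (c : {ffun cbas koz p.+1 -> S}) :
  dmap c = 0 -> exists b : {ffun cbas koz p.+2 -> S}, c = dmap b.
Proof.
move=> c0; have d0 J : kdiff (kext c) J = 0.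
  have [Jp|Jp] := eqVneq #|J| p.
    have Jp' : #|J| == p by apply/eqP.
    by have /ffunP/(_ (exist _ J Jp')) := c0; rewrite dmap_koszul ffunE.
  rewrite /kdiff big1 // => i iJ; rewrite kext_out ?mulr0 //.
  by rewrite cardsU1 iJ eqSS.
exists [ffun I => khomotopy (kext c) (val I)]; apply/ffunP => J.
rewrite dmap_koszul -kextE (koszul_exact d0); last first.
  by rewrite -card_gt0 (eqP (valP J)).
apply: eq_bigr => i iJ; congr (_ * _).
have ip : #|i |: val J| == p.+2 by rewrite cardsU1 iJ (eqP (valP J)).
by rewrite (kext_in _ ip) ffunE.
Qed.

End KoszulComplex.

Section KoszulSyzygies.
Variables (K : fieldType) (n : nat).
Local Notation S := {mpoly K[n]}.
Local Notation koz := (koszul K n).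

(** The relation among the variables given by an element of the second term of
the Koszul complex. *)
Definition syzygy (b : {ffun cbas koz 2 -> S}) : 'rV[S]_n :=
  \row_j kdiff (kext b) [set j].

(** Exactness of the Koszul complex at its first term. *)
Lemma syzygyP (y : 'rV[S]_n) :
  \sum_j y 0 j * 'X_j = 0 <-> exists b, y = syzygy b.
Proof.
have E0 (c : {set 'I_n} -> S) : kdiff c set0 = \sum_j 'X_j * c [set j].
  rewrite /kdiff; apply: eq_big => [j|j _]; first by rewrite inE.
  by rewrite setU0 ksign_min ?mul1r // => k; rewrite inE.
split=> [y0|[b ->]]; last first.
  rewrite -[RHS](kdiff_kdiff (kext b) set0) E0; apply: eq_bigr => j _.
  by rewrite mxE mulrC.
pose c : {ffun cbas koz 1 -> S} :=
  [ffun I : cbas koz 1 => \sum_(j in val I) y 0 j].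
have cE j : kext c [set j] = y 0 j.
  have j1 : #|[set j]| == 1%N by rewrite cards1.
  by rewrite (kext_in _ j1) ffunE /= big_set1.
have [|b bE] := @koszul_cycle _ _ 0 c.
  apply/ffunP => J; rewrite dmap_koszul ffunE.
  have -> : val J = set0 by apply/eqP; rewrite -cards_eq0 (valP J).
  by rewrite E0 -[RHS]y0; apply: eq_bigr => j _; rewrite cE mulrC.
exists b; apply/rowP => j; rewrite mxE -cE.
have j1 : #|[set j]| == 1%N by rewrite cards1.
by rewrite (kext_in _ j1) bE dmap_koszul.
Qed.

Lemma syzygy_eq0 b : syzygy b = 0 <-> dmap b = 0.
Proof.
split=> [/rowP b0|b0].
  apply/ffunP => J; rewrite dmap_koszul ffunE.
  have /cards1P[j ->] : #|val J| == 1%N by apply: (valP J).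
  by have := b0 j; rewrite !mxE.
apply/rowP => j; rewrite !mxE; have j1 : #|[set j]| == 1%N by rewrite cards1.
have /ffunP/(_ (exist (fun I : {set 'I_n} => #|I| == 1%N) [set j] j1)) := b0.
by rewrite dmap_koszul ffunE.
Qed.

Lemma syzygy_lin a (b b' : {ffun cbas koz 2 -> S}) :
  syzygy [ffun I => a * b I + b' I] = a *: syzygy b + syzygy b'.
Proof.
apply/rowP => j; rewrite !mxE /kdiff mulr_sumr -big_split; apply: eq_bigr => i _ /=.
rewrite /kext; case: insub => [I|] /=; last by rewrite !mulr0 addr0.
by rewrite ffunE; ring.
Qed.

Lemma syzygy_homog I j : syzygy [ffun J => (J == I)%:R] 0 j \is 1.-homog.
Proof.
rewrite mxE; apply: rpred_sum => i _; rewrite /ksign -mulrA -signr_odd.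
rewrite rpredMsign /kext; case: insub => [J|] /=; last by rewrite mulr0 rpred0.
rewrite ffunE; case: (J == I); last by rewrite mulr0 rpred0.
by rewrite mulr1 dhomogX /= mdeg1.
Qed.

End KoszulSyzygies.

(** * Derivations tangent to hyperplanes *)

Section Derivations.
Variables (K : fieldType) (n : nat).
Local Notation S := {mpoly K[n]}.
Local Notation x i := (linform (xvec K n i)).
Implicit Type theta : 'rV[S]_n.

Lemma derapp_linform theta a :
  derapp theta (linform a) = \sum_i a 0 i *: theta 0 i.
Proof.
apply: eq_bigr => i _; rewrite /linform raddf_sum (bigD1 i) //= big1 => [|j ji].
  rewrite mderivZ mderivX mnm1E eqxx scale1r.
  by rewrite -[X in (X - _)%MM]add0m addmK mpolyX0 addr0 -scalerAr mulr1.
by rewrite mderivZ mderivX mnm1E (negbTE ji) scale0r scaler0.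
Qed.

Lemma derapp_linformD theta a b :
  derapp theta (linform (a + b)) = derapp theta (linform a) + derapp theta (linform b).
Proof.
by rewrite !derapp_linform -big_split; apply: eq_bigr => i _; rewrite mxE scalerDl.
Qed.

Lemma derapp_linformZ theta c a :
  derapp theta (linform (c *: a)) = c *: derapp theta (linform a).
Proof.
by rewrite !derapp_linform scaler_sumr; apply: eq_bigr => i _; rewrite mxE scalerA.
Qed.

Lemma derapp_linformB theta a b :
  derapp theta (linform (a - b)) = derapp theta (linform a) - derapp theta (linform b).
Proof. by rewrite derapp_linformD -scaleN1r derapp_linformZ scaleN1r. Qed.

(** Indexed by [nat], since the arrangements relate coefficients of consecutive
indices. *)
Definition coef theta (i : nat) : S := derapp theta (x i).

Lemma coefE theta (i : 'I_n) : coef theta i = theta 0 i.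
Proof.
rewrite /coef derapp_linform (bigD1 i) //= mxE eqxx scale1r big1 ?addr0 // => j ji.
by rewrite mxE val_eqE (negbTE ji) scale0r.
Qed.

Lemma coef_row (F : nat -> S) i : (i < n)%N -> coef (\row_j F j) i = F i.
Proof. by move=> lt; rewrite (coefE _ (Ordinal lt)) mxE. Qed.

Lemma coef_inj theta theta' :
  (forall i, (i < n)%N -> coef theta i = coef theta' i) -> theta = theta'.
Proof. by move=> E; apply/rowP => i; rewrite -!coefE E. Qed.

Lemma coef_lin a theta theta' i :
  coef (a *: theta + theta') i = a * coef theta i + coef theta' i.
Proof.
rewrite /coef !derapp_linform mulr_sumr -big_split; apply: eq_bigr => j _ /=.
by rewrite !mxE scalerDr scalerAr.
Qed.

Lemma coef_zero i : coef 0 i = 0.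
Proof. by rewrite /coef derapp_linform big1 // => j _; rewrite [X in _ *: X]mxE scaler0. Qed.

(** The entries satisfy the equations of proportionality; that [a] is nonzero where
[b] is follows from [hyp a] being a proper subspace. *)
Lemma hyp_proportional (a b : 'rV[K]_n) : b != 0 -> hyp a = hyp b ->
  exists c, c != 0 /\ a = c *: b.
Proof.
move=> /rV0Pn[i bi] ab; have minor := hyp_minor ab i.
have ai : a 0 i != 0.
  apply: contraNneq (bi) => ai.
  have a0 : a = 0.
    apply/rowP => j; have := minor j; rewrite ai mul0r mxE => /esym/eqP.
    by rewrite mulf_eq0 (negbTE bi) orbF => /eqP.
  have : delta_mx 0 i \in hyp b by rewrite -ab mem_hyp a0 trmx0 mulmx0.
  by rewrite mem_hyp -rowE => /eqP/rowP/(_ 0); rewrite !mxE => ->.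
exists (a 0 i / b 0 i); split; first by rewrite mulf_neq0 ?invr_eq0.
by apply/rowP => j; rewrite mxE mulrAC minor; field.
Qed.

(** The condition for one form defining the hyperplane implies it for its multiples,
so a list of defining forms suffices. *)
Lemma derlog_forms (A : seq {vspace 'rV[K]_n}) m s theta :
    A =i [seq hyp a | a <- s] -> all (fun a => a != 0) s ->
  derlog A m theta <->
  {in s, forall a, dvd (linform a ^+ m (hyp a)) (derapp theta (linform a))}.
Proof.
move=> As s0; split=> [D a a_s|D H a].
  by apply: D => //; rewrite As map_f.
rewrite As => /mapP[b bs ->] ba.
have [c [c0 ->]] := hyp_proportional (allP s0 b bs) (esym ba).
have [q qE] := D b bs; exists ((c / c ^+ m (hyp b)) *: q).
rewrite derapp_linformZ linformZ qE exprZn -scalerAr -scalerAl scalerA.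
by rewrite [c ^+ _ * _]mulrCA divff ?expf_neq0 // mulr1.
Qed.

End Derivations.

(** * Sequences with prescribed consecutive differences *)

Lemma bounded_choice (T : Type) (t0 : T) N (P : nat -> T -> Prop) :
  (forall i, (i < N)%N -> exists y, P i y) ->
  exists f, forall i, (i < N)%N -> P i (f i).
Proof.
move=> PN; have [f fP] := fin_all_exists (fun i : 'I_N => PN i (ltn_ord i)).
exists (fun i => oapp f t0 (insub i)) => i lt.
by rewrite insubT /=; apply: (fP (Ordinal lt)).
Qed.

Section Chain.
Variable (R : comNzRingType).
Implicit Types (l g f : nat -> R).

(** The difference [f 0 - f k] of a sequence with [f i - f i.+1 = l i * g i]. *)
Definition descent l g k : R := \sum_(0 <= i < k) l i * g i.

Lemma descentS l g k : descent l g k.+1 = descent l g k + l k * g k.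
Proof. by rewrite /descent big_nat_recr. Qed.

Lemma descent0 l g : descent l g 0 = 0.
Proof. by rewrite /descent big_nil. Qed.

Lemma descent_lin l a g h k :
  descent l (fun i => a * g i + h i) k = a * descent l g k + descent l h k.
Proof. by rewrite mulr_sumr -big_split; apply: eq_bigr => i _ /=; ring. Qed.

Lemma descent_ext l g h k : (forall i, (i < k)%N -> g i = h i) ->
  descent l g k = descent l h k.
Proof. by move=> E; apply: eq_big_nat => i /andP[_ lt]; rewrite E. Qed.

Lemma descentP l f N : (forall k, (k < N)%N -> dvd (l k) (f k - f k.+1)) <->
  exists g, forall k, (k <= N)%N -> f k = f 0%N - descent l g k.
Proof.
split=> [lf|[g fE] k kN]; last first.
  by exists (g k); rewrite (fE k) 1?ltnW // (fE k.+1) // descentS; ring.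
have [g gE] := bounded_choice (0 : R) lf.
exists g; elim=> [|k IH] kN; first by rewrite descent0 subr0.
rewrite descentS opprD addrA -IH 1?ltnW //.
by have := gE _ kN; rewrite mulrC => <-; ring.
Qed.

Lemma descent_inj l g N (a : R) : (forall k b, (k < N)%N -> l k * b = 0 -> b = 0) ->
  (forall k, (k <= N)%N -> a - descent l g k = 0) ->
  a = 0 /\ forall k, (k < N)%N -> g k = 0.
Proof.
move=> l0 E; have a0 : a = 0 by have := E 0%N isT; rewrite descent0 subr0.
split=> // k kN; apply: (l0 k) => //.
have := E k.+1 kN; have := E k (ltnW kN); rewrite descentS a0 => E1 E2.
have -> : l k * g k = 0 - descent l g k - (0 - (descent l g k + l k * g k)) by ring.
by rewrite E1 E2 subr0.
Qed.

Section ClosedChain.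
Variables (l : nat -> R) (ell c d : R) (N : nat).
Hypothesis dc : d * (c - 1) = 1.

(** The sequence with [f i - f i.+1 = l i * g i] for i < N and
[c * f N - f 0 = ell * g N]: by the first condition the second one is
[(c - 1) * f 0 = c * descent l g N + ell * g N], which determines [f 0]. *)
Definition cyclic g k : R := d * (c * descent l g N + ell * g N) - descent l g k.

Lemma cyclic_lin a g h k :
  cyclic (fun i => a * g i + h i) k = a * cyclic g k + cyclic h k.
Proof. by rewrite /cyclic !descent_lin; ring. Qed.

Lemma cyclic_ext g h k : (forall i, (i <= N)%N -> g i = h i) -> (k <= N)%N ->
  cyclic g k = cyclic h k.
Proof.
move=> E kN; rewrite /cyclic (E N) //.
congr (_ * (_ * _ + _) - _); apply: descent_ext => i lt; apply: E.
  exact: ltnW.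
by rewrite ltnW // (leq_trans lt).
Qed.

Lemma cyclicP f :
  ((forall k, (k < N)%N -> dvd (l k) (f k - f k.+1)) /\ dvd ell (c * f N - f 0%N)) <->
  exists g, forall k, (k <= N)%N -> f k = cyclic g k.
Proof.
split=> [[/descentP[g fE] [h hE]]|[g fE]].
  exists (fun k => if k == N then h else g k).
  have dE k : (k <= N)%N -> descent l (fun k => if k == N then h else g k) k = descent l g k.
    by move=> kN; apply: descent_ext => i ik; rewrite ltn_eqF // (leq_trans ik).
  move=> k kN; rewrite /cyclic eqxx !dE // [LHS]fE //; congr (_ - _).
  rewrite (fE N) // in hE; rewrite [ell * h]mulrC -hE.
  rewrite -[LHS]mul1r -dc; ring.
have f0 := fE 0%N isT; rewrite /cyclic descent0 subr0 in f0.
split; first by apply/descentP; exists g => k kN; rewrite f0 fE.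
exists (g N); rewrite f0 (fE N) // /cyclic.
set D := descent _ _ _; transitivity (d * (c - 1) * (c * D + ell * g N) - c * D).
  by ring.
by rewrite dc; ring.
Qed.

Lemma cyclic_inj g : (forall k b, (k < N)%N -> l k * b = 0 -> b = 0) ->
  (forall b, ell * b = 0 -> b = 0) ->
  (forall k, (k <= N)%N -> cyclic g k = 0) -> forall k, (k <= N)%N -> g k = 0.
Proof.
move=> l0 e0 g0; have [a0 gN] := descent_inj l0 g0.
move=> k; rewrite leq_eqVlt => /orP[/eqP ->|/gN //]; apply: e0.
have D0 : descent l g N = 0.
  by rewrite (descent_ext _ gN) /descent big1 // => i _; rewrite mulr0.
have := congr1 (fun z => (c - 1) * z) a0.
by rewrite D0 !mulr0 add0r mulrA [_ * d]mulrC dc mul1r.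
Qed.

End ClosedChain.

End Chain.

(** * Linear forms as primes *)

Section LinearPrimes.
Variables (K : fieldType) (n : nat).
Local Notation S := {mpoly K[n]}.
Local Notation x i := (linform (xvec K n i)).

Definition is_prime (l : S) : Prop := forall f g, dvd l (f * g) -> ~ dvd l f -> dvd l g.

Lemma prime_xBZ i j c : (i < n)%N -> (j < n)%N -> i != j -> is_prime (x i - c%:MP * x j).
Proof.
move=> ltin ltj ij f g; apply: linear_form_prime => //.
by rewrite rmorphM /= substX // eq_sym (negbTE ij) /subst endoC.
Qed.

Lemma prime_xB i j : (i < n)%N -> (j < n)%N -> i != j -> is_prime (x i - x j).
Proof. by move=> *; rewrite -[x j]mul1r -(rmorph1 (@mpolyC n K)); apply: prime_xBZ. Qed.

Lemma not_dvd (H : nat -> K) (l f : S) : ev idfun H l = 0 -> ev idfun H f != 0 -> ~ dvd l f.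
Proof. by move=> l0 f0 [q E]; case/eqP: f0; rewrite E rmorphM /= l0 mulr0. Qed.

Lemma neq0_ev (H : nat -> K) (f : S) : ev idfun H f != 0 -> f != 0.
Proof. by apply: contraNneq => ->; rewrite rmorph0. Qed.

(** Modulo [l], both weights are equal and can be cancelled. *)
Lemma prime_dvdB l f g a b : is_prime l -> dvd l (a - b) -> ~ dvd l b ->
  dvd l (a * f - b * g) <-> dvd l (f - g).
Proof.
move=> pl ab nb; have E : a * f - b * g = b * (f - g) + f * (a - b) by ring.
rewrite E; split=> [D|D]; last by apply: dvdD; apply: dvdMr.
apply: (pl b) nb; have [p pE] := ab; have [q qE] := D.
by exists (q - f * p); rewrite mulrBl -qE -mulrA -pE; ring.
Qed.

Lemma prime_mul_dvd l l' f : is_prime l -> ~ dvd l l' -> dvd l f -> dvd l' f ->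
  dvd (l * l') f.
Proof.
move=> pl ll' lf [q E]; have [p pE] : dvd l q by apply: (pl l') ll'; rewrite mulrC -E.
by exists p; rewrite E pE mulrA.
Qed.

End LinearPrimes.

Lemma dvd_subX (R : comNzRingType) (a b : R) d : dvd (a - b) (a ^+ d - b ^+ d).
Proof. by rewrite subrXX mulrC; exists (\sum_(i < d) a ^+ (d.-1 - i) * b ^+ i). Qed.

Lemma dvd_scale (K : fieldType) n (l f : {mpoly K[n]}) c : c != 0 ->
  dvd l (c%:MP * f) <-> dvd l f.
Proof.
move=> c0; split=> [D|]; last exact: dvdMr.
by rewrite -[f]mul1r -mpolyC1 -(mulVf c0) mpolyCM -mulrA; apply: dvdMr.
Qed.

(** * The restricted arrangement *)

Section Restricted.
Variable K : fieldType.
Variables (r : nat) (t : K).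
Hypotheses (charK : [pchar K] =i pred0) (r3 : (3 <= r)%N) (t0 : t != 0).
Local Notation S := {mpoly K[r]}.
Local Notation x i := (linform (xvec K r i)).

Let l i : S := x i - x i.+1.
Let ell : S := x r.-1 - t%:MP * x 0%N.

Lemma hyp_diff_notin b : b \in [seq xvec K r i - xvec K r i.+1 | i <- iota 0 r.-1]
    ++ [:: xvec K r r.-1 - t *: xvec K r 0] ->
  (hyp b \in [seq hyp a | a <- [seq xvec K r i | i <- iota 0 r]]) = false.
Proof.
have := ArtH0_forms_uniq r3 t0; rewrite map_cat cat_uniq => /and3P[_ /hasPn dis _] bs.
by apply/negbTE/dis/map_f.
Qed.

(** Stated for a multiplicity [d] along the coordinate hyperplanes, which covers
both the simple arrangement and the Ziegler multiplicity. *)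
Lemma derlog_ArtH0 m d theta :
    (forall b, b \in ArtH0_forms r t -> m (hyp b) =
      if hyp b \in [seq hyp a | a <- [seq xvec K r i | i <- iota 0 r]]
      then d else 1%N) ->
  derlog (ArtH0 r t) m theta <->
  [/\ forall i, (i < r)%N -> dvd (x i ^+ d) (coef theta i),
      forall i, (i < r.-1)%N -> dvd (l i) (coef theta i - coef theta i.+1)
    & dvd ell (coef theta r.-1 - t%:MP * coef theta 0%N)].
Proof.
move=> Em; rewrite (derlog_forms _ _ (perm_mem (ArtH0_perm charK r3 t0))); last first.
  exact: ArtH0_forms_neq0.
have m1 b : b \in [seq xvec K r i - xvec K r i.+1 | i <- iota 0 r.-1] ++
    [:: xvec K r r.-1 - t *: xvec K r 0] -> m (hyp b) = 1%N.
  by move=> bs; rewrite Em ?hyp_diff_notin // /ArtH0_forms mem_cat bs orbT.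
have md i : (i < r)%N -> m (hyp (xvec K r i)) = d.
  move=> lt; have xi : xvec K r i \in [seq xvec K r i | i <- iota 0 r].
    by rewrite map_f // mem_iota.
  by rewrite Em ?(map_f (@hyp K r) xi) // /ArtH0_forms mem_cat xi.
have lE i : linform (xvec K r i - xvec K r i.+1) = l i by rewrite linformB.
have ellE : linform (xvec K r r.-1 - t *: xvec K r 0) = ell.
  by rewrite linformB linformZ -mul_mpolyC.
split=> [D|[Dx Dl De] b].
  split=> [i lt|i lt|].
  - rewrite -(md _ lt); apply: D.
    by rewrite /ArtH0_forms mem_cat map_f // mem_iota.
  - have bs : xvec K r i - xvec K r i.+1 \in
        [seq xvec K r i - xvec K r i.+1 | i <- iota 0 r.-1].
      by apply: (map_f (fun i => xvec K r i - xvec K r i.+1)); rewrite mem_iota.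
    have bf : xvec K r i - xvec K r i.+1 \in ArtH0_forms r t.
      by rewrite /ArtH0_forms !mem_cat bs !orbT.
    by have := D _ bf; rewrite m1 ?mem_cat ?bs // expr1 derapp_linformB lE.
  have bf : xvec K r r.-1 - t *: xvec K r 0 \in ArtH0_forms r t.
    by rewrite /ArtH0_forms !mem_cat inE eqxx !orbT.
  have := D _ bf; rewrite m1 ?mem_cat ?inE ?eqxx ?orbT // expr1.
  by rewrite derapp_linformB derapp_linformZ -mul_mpolyC ellE.
rewrite mem_cat => /orP[/mapP[i]|bs].
  by rewrite mem_iota => /= lt ->; rewrite md //; apply: Dx.
rewrite m1 // expr1; move: bs; rewrite mem_cat => /orP[/mapP[i]|].
  by rewrite mem_iota => /= lt ->; rewrite derapp_linformB lE; apply: Dl.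
by rewrite inE => /eqP ->; rewrite derapp_linformB derapp_linformZ -mul_mpolyC ellE.
Qed.

Lemma derlog_ArtH0_simple theta :
  derlog (ArtH0 r t) simple theta <->
  [/\ forall i, (i < r)%N -> dvd (x i ^+ 1) (coef theta i),
      forall i, (i < r.-1)%N -> dvd (l i) (coef theta i - coef theta i.+1)
    & dvd ell (coef theta r.-1 - t%:MP * coef theta 0%N)].
Proof. by apply: derlog_ArtH0 => b _; case: ifP. Qed.

Lemma derlog_ArtH0_ziegler theta :
  derlog (ArtH0 r t) (mH0 r t) theta <->
  [/\ forall i, (i < r)%N -> dvd (x i ^+ 2) (coef theta i),
      forall i, (i < r.-1)%N -> dvd (l i) (coef theta i - coef theta i.+1)
    & dvd ell (coef theta r.-1 - t%:MP * coef theta 0%N)].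
Proof. by apply: derlog_ArtH0 => b /(mH0_count charK r3 t0) ->; case: (_ \in _). Qed.

Lemma x_neq0 i : (i < r)%N -> x i != 0.
Proof.
by move=> lt; apply: (@neq0_ev _ _ (fun=> 1)); rewrite evX ?oner_eq0.
Qed.

Lemma l_prime i : (i < r.-1)%N -> is_prime (l i).
Proof. by move=> lt; apply: prime_xB; lia. Qed.

Lemma ell_prime : is_prime ell.
Proof. by apply: prime_xBZ; lia. Qed.

Lemma l_ndvd i j d : (i < r.-1)%N -> (j < r)%N -> ~ dvd (l i) (x j ^+ d).
Proof.
move=> lt ltj; apply: (@not_dvd _ _ (fun=> 1)).
  by rewrite rmorphB /= !evX ?subrr //; lia.
by rewrite rmorphXn /= evX // expr1n oner_eq0.
Qed.

Lemma ell_ndvd c d : c != 0 -> ~ dvd ell (c%:MP * x 0%N ^+ d).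
Proof.
move=> c0; apply: (@not_dvd _ _ (fun i => if i == 0%N then 1 else t)).
  rewrite rmorphB rmorphM /= evC !evX /=; [|lia|lia].
  have -> : (r.-1 == 0)%N = false by lia.
  by rewrite mulr1 subrr.
by rewrite rmorphM rmorphXn /= evX ?evC ?expr1n ?mulr1 //; lia.
Qed.

Lemma l_neq0 i : (i < r.-1)%N -> l i != 0.
Proof.
move=> lt; apply: (@neq0_ev _ _ (fun j => (j == i)%:R)).
rewrite rmorphB /= !evX; [|lia|lia].
by rewrite eqxx gtn_eqF // subr0 oner_eq0.
Qed.

Lemma ell_neq0 : ell != 0.
Proof.
apply: (@neq0_ev _ _ (fun j => (j == r.-1)%:R)).
rewrite rmorphB rmorphM /= evC !evX; [|lia|lia].
have -> : (0 == r.-1)%N = false by lia.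
by rewrite mulr0 eqxx subr0 oner_eq0.
Qed.

(** Modulo [l i] the weights x_i^d and x_(i+1)^d agree and cancel; modulo [ell]
one has x_r^d = t^d x_1^d, whence the constants in the last condition. *)
Lemma ArtH0_factor d theta :
  [/\ forall i, (i < r)%N -> dvd (x i ^+ d) (coef theta i),
      forall i, (i < r.-1)%N -> dvd (l i) (coef theta i - coef theta i.+1)
    & dvd ell (coef theta r.-1 - t%:MP * coef theta 0%N)] <->
  exists f : nat -> S, [/\ forall i, (i < r)%N -> coef theta i = x i ^+ d * f i,
      forall i, (i < r.-1)%N -> dvd (l i) (f i - f i.+1)
    & dvd ell ((t ^+ d)%:MP * f r.-1 - t%:MP * f 0%N)].
Proof.
have chg f i : (i < r.-1)%N ->
    dvd (l i) (x i ^+ d * f i - x i.+1 ^+ d * f i.+1) <-> dvd (l i) (f i - f i.+1).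
  move=> lt; apply: prime_dvdB; [exact: l_prime|exact: dvd_subX|].
  by apply: l_ndvd => //; lia.
have che (f : nat -> S) : dvd ell (x r.-1 ^+ d * f r.-1 - t%:MP * (x 0%N ^+ d * f 0%N)) <->
    dvd ell ((t ^+ d)%:MP * f r.-1 - t%:MP * f 0%N).
  have td : t ^+ d != 0 by rewrite expf_neq0.
  have -> : t%:MP * (x 0%N ^+ d * f 0%N) =
      (t ^+ d)%:MP * x 0%N ^+ d * ((t / t ^+ d)%:MP * f 0%N).
    have -> : t%:MP = (t ^+ d)%:MP * (t / t ^+ d)%:MP :> S.
      by rewrite -mpolyCM mulrC divfK.
    ring.
  rewrite prime_dvdB; [|exact: ell_prime| |exact: ell_ndvd].
    rewrite -(dvd_scale _ _ td) mulrBr mulrA -mpolyCM.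
    have -> : t ^+ d * (t / t ^+ d) = t by rewrite mulrC divfK.
    exact: iff_refl.
  by rewrite rmorphXn -exprMn; apply: dvd_subX.
split=> [[Dx Dl De]|[f [fE Dl De]]].
  have [f fE] := bounded_choice (0 : S) Dx.
  have {}fE i : (i < r)%N -> coef theta i = x i ^+ d * f i.
    by move/fE; rewrite mulrC.
  exists f; split=> // [i lt|]; first by rewrite -chg // -!fE //; [apply: Dl|lia|lia].
  by rewrite -che -!fE //; lia.
split=> [i lt|i lt|]; first by exists (f i); rewrite fE // mulrC.
  by rewrite !fE; [rewrite chg //; apply: Dl|lia|lia].
by rewrite !fE; [rewrite che|lia|lia].
Qed.

(** With weights x_i^2 the last condition is [ell | t * f_r - f_1], up to the
factor t, so [cyclic] parametrizes the module. *)
Lemma ziegler_free : t != 1 -> is_free (derlog (ArtH0 r t) (mH0 r t)).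
Proof.
move=> t1; pose d : S := ((t - 1)^-1)%:MP.
have dc : d * (t%:MP - 1) = 1.
  by rewrite /d -mpolyC1 -mpolyCB -mpolyCM mulVf ?subr_eq0.
pose ch := cyclic l ell t%:MP d r.-1.
have chP f : ((forall i, (i < r.-1)%N -> dvd (l i) (f i - f i.+1)) /\
      dvd ell ((t ^+ 2)%:MP * f r.-1 - t%:MP * f 0%N)) <->
    exists g, forall k, (k <= r.-1)%N -> f k = ch g k.
  rewrite -(cyclicP l ell r.-1 dc) -[dvd ell (t%:MP * _ - _)](dvd_scale _ _ t0).
  by rewrite mulrBr mulrA -mpolyCM -expr2.
pose Phi (g : nat -> S) : 'rV[S]_r := \row_(j < r) (x j ^+ 2 * ch g j).
have PhiE g i : (i < r)%N -> coef (Phi g) i = x i ^+ 2 * ch g i.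
  by move=> lt; rewrite (coef_row (fun j => x j ^+ 2 * ch g j)).
apply: (@free_of_parametrization _ _ _ r Phi).
- move=> a g h; apply: coef_inj => i lt; rewrite coef_lin !PhiE //.
  by rewrite /ch cyclic_lin; ring.
- move=> g h E; apply: coef_inj => i lt; rewrite !PhiE //; congr (_ * _).
  by apply: cyclic_ext; [move=> j jr; apply: E|]; lia.
- move=> theta; rewrite derlog_ArtH0_ziegler ArtH0_factor.
  split=> [[f [fE Dl De]]|[g ->]].
    have [g gE] : exists g, forall k, (k <= r.-1)%N -> f k = ch g k by apply/chP.
    by exists g; apply: coef_inj => i lt; rewrite fE // PhiE // gE //; lia.
  have [Dl De] := (chP (ch g)).2 (ex_intro _ g (fun k _ => erefl)).
  by exists (ch g); split=> //; apply: PhiE.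
move=> g g0 k kr; apply: (@cyclic_inj _ l ell t%:MP d r.-1) => //; last by lia.
- by move=> i b lt /eqP; rewrite mulf_eq0 (negbTE (l_neq0 lt)) => /eqP.
- by move=> b /eqP; rewrite mulf_eq0 (negbTE ell_neq0) => /eqP.
move=> i ir; have lt : (i < r)%N by lia.
have := PhiE g i lt; rewrite g0 coef_zero => /esym/eqP.
by rewrite mulf_eq0 expf_eq0 (negbTE (x_neq0 lt)) => /eqP.
Qed.

Let form (i : nat) : 'rV[K]_r :=
  if (i < r.-1)%N then xvec K r i - xvec K r i.+1
  else xvec K r r.-1 - t *: xvec K r 0.

Let L : 'M[K]_r := \matrix_(i < r) form i.

Lemma formE i : linform (form i) = if (i < r.-1)%N then l i else ell.
Proof. by rewrite /form; case: ifP => _; rewrite linformB // linformZ -mul_mpolyC. Qed.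

(** At a common zero of the forms all coordinates are equal, and the last of them is
t times the first. *)
Lemma forms_basis : t != 1 -> L \in unitmx.
Proof.
move=> t1; rewrite -unitmx_tr -row_free_unit; apply: inj_row_free => u uL.
pose val i := (u *m (xvec K r i)^T) 0 0.
have valE (i : 'I_r) : val i = u 0 i.
  rewrite /val mxE (bigD1 i) //= !mxE eqxx mulr1 big1 ?addr0 // => j ji.
  by rewrite !mxE val_eqE (negbTE ji) mulr0.
have uf i : (i < r)%N -> (u *m (form i)^T) 0 0 = 0.
  move=> ir; have := congr1 (fun z : 'rV_r => z 0 (Ordinal ir)) uL; rewrite !mxE => E.
  by rewrite -[RHS]E; apply: eq_bigr => j _; rewrite !mxE.
have step i : (i < r.-1)%N -> val i = val i.+1.
  move=> ir; have := uf i; rewrite /form ir linearB /= mulmxBr => E.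
  have {}E : val i - val i.+1 = 0 by rewrite -[RHS]E ?[RHS]mxE ?[X in _ = _ + X]mxE //; lia.
  by apply/eqP; rewrite -subr_eq0 E.
have v0 i : (i <= r.-1)%N -> val i = val 0%N.
  by elim: i => // i IH ir; rewrite -step // IH // ltnW.
have last0 : val r.-1 - t * val 0%N = 0.
  have lt : (r.-1 < r)%N by lia.
  have := uf r.-1 lt; rewrite /form ltnn linearB linearZ /= mulmxBr -scalemxAr => E.
  by rewrite -[RHS]E [RHS]mxE [X in _ = _ + X]mxE [X in _ = _ - X]mxE.
have z0 : val 0%N = 0.
  move/eqP: last0; rewrite v0 // -{1}[val 0%N]mul1r -mulrBl mulf_eq0 subr_eq0 eq_sym.
  by rewrite (negbTE t1) => /eqP.
by apply/rowP => i; rewrite -valE v0 ?z0 ?mxE //; have := ltn_ord i; lia.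
Qed.

Let entry (g : 'rV[S]_r) (i : nat) : S := oapp (g 0) 0 (insub i).

Lemma entryE (g : 'rV[S]_r) (i : 'I_r) : entry g i = g 0 i.
Proof. by rewrite /entry valK. Qed.

Let LS : 'M[S]_r := map_mx (@mpolyC r K) L.

(** A relation [g] among the forms, rewritten in the variables, is the relation
[g *m LS] among the variables. *)
Lemma relation_syzygy (g : 'rV[S]_r) :
  descent l (entry g) r.-1 + ell * entry g r.-1 = 0 <->
  \sum_j (g *m LS) 0 j * 'X_j = 0.
Proof.
suff -> : \sum_j (g *m LS) 0 j * 'X_j = descent l (entry g) r.-1 + ell * entry g r.-1 by [].
transitivity (\sum_(i < r) linform (form i) * entry g i).
  rewrite (eq_bigr (fun j => \sum_i g 0 i * (LS i j * 'X_j))) => [|j _]; last first.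
    by rewrite mxE mulr_suml; apply: eq_bigr => i _; rewrite mulrA.
  rewrite exchange_big /=; apply: eq_bigr => i _; rewrite -mulr_sumr mulrC entryE.
  by congr (_ * _); apply: eq_bigr => j _; rewrite !mxE mul_mpolyC.
have r1 : r = r.-1.+1 by lia.
rewrite -(big_mkord xpredT (fun i => linform (form i) * entry g i)).
rewrite [X in \sum_(0 <= i < X) _]r1 big_nat_recr //= [in RHS]/descent.
congr (_ + _); last by rewrite formE ltnn.
by apply: eq_big_nat => i /andP[_ ir]; rewrite formE ir.
Qed.

(** The derivation x_i (s - sum_(k < i) l_k g_k) d/dx_i, where [g] is the relation
among the forms that corresponds to the relation [y] among the variables.  It is
specified by its coefficients and kept folded. *)
Fact syz_der_spec : {d : S -> 'rV[S]_r -> 'rV[S]_r | forall s y i, (i < r)%N ->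
  coef (d s y) i =
    x i * (s - descent l (entry (y *m map_mx (@mpolyC r K) (invmx L))) i)}.
Proof.
pose F s y j := x j * (s - descent l (entry (y *m map_mx (@mpolyC r K) (invmx L))) j).
by exists (fun s y => \row_(j < r) F s y j) => s y i lt; rewrite (coef_row (F s y)).
Qed.

Definition syz_der : S -> 'rV[S]_r -> 'rV[S]_r := sval syz_der_spec.

Lemma coef_syz_der s y i : (i < r)%N -> coef (syz_der s y) i =
  x i * (s - descent l (entry (y *m map_mx (@mpolyC r K) (invmx L))) i).
Proof. exact: (svalP syz_der_spec). Qed.

Lemma syz_der_lin a s s' y y' :
  syz_der (a * s + s') (a *: y + y') = a *: syz_der s y + syz_der s' y'.
Proof.
apply: coef_inj => i lt; rewrite coef_lin (coef_syz_der _ (a *: y + y') lt).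
rewrite (coef_syz_der s y lt) (coef_syz_der s' y' lt) mulmxDl -scalemxAl.
move: (y *m _) (y' *m _) => u v.
rewrite (@descent_ext _ _ _ (fun k => a * entry u k + entry v k)) ?descent_lin; first by ring.
move=> k _; rewrite /entry; case: insub => [k'|] /=; last by rewrite mulr0 addr0.
by rewrite !mxE.
Qed.

Lemma forms_mulV : t != 1 -> LS *m map_mx (@mpolyC r K) (invmx L) = 1%:M.
Proof. by move=> t1; rewrite -map_mxM mulmxV ?forms_basis // map_mx1. Qed.

Lemma forms_mulVl : t != 1 -> map_mx (@mpolyC r K) (invmx L) *m LS = 1%:M.
Proof. by move=> t1; rewrite -map_mxM mulVmx ?forms_basis // map_mx1. Qed.

(** The first r - 1 entries of the relation can be read off the coefficients of
the derivation; the relation itself gives the last one. *)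
Lemma syz_der_eq0 s (y : 'rV[S]_r) : t != 1 -> \sum_j y 0 j * 'X_j = 0 ->
  syz_der s y = 0 -> s = 0 /\ y = 0.
Proof.
move=> t1 y0 d0; set g := y *m map_mx (@mpolyC r K) (invmx L).
have yg : y = g *m LS by rewrite -mulmxA forms_mulVl // mulmx1.
have [||s0 g0] := @descent_inj _ l (entry g) r.-1 s.
- by move=> i b lt /eqP; rewrite mulf_eq0 (negbTE (l_neq0 lt)) => /eqP.
- move=> i ir; have lt : (i < r)%N by lia.
  have /eqP := coef_syz_der s y lt; rewrite d0 coef_zero eq_sym mulf_eq0.
  by rewrite (negbTE (x_neq0 lt)) => /eqP.
split=> //; rewrite yg; suff -> : g = 0 by rewrite mul0mx.
have gl : entry g r.-1 = 0.
  move: y0; rewrite yg -relation_syzygy (descent_ext _ g0) /descent big1 => [|i _].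
    by rewrite add0r => /eqP; rewrite mulf_eq0 (negbTE ell_neq0) => /eqP.
  by rewrite mulr0.
apply/rowP => i; rewrite -entryE mxE.
have [ir|ir] := ltnP i r.-1; first exact: g0.
by have -> : (i : nat) = r.-1 by have := ltn_ord i; lia.
Qed.

(** With weights x_i the last condition is [ell | f_r - f_1], and its quotient is the
last entry of a relation among the forms. *)
Lemma derlog_syz_der theta : t != 1 -> derlog (ArtH0 r t) simple theta <->
  exists s (y : 'rV[S]_r), \sum_j y 0 j * 'X_j = 0 /\ theta = syz_der s y.
Proof.
move=> t1; rewrite derlog_ArtH0_simple ArtH0_factor.
have de f : dvd ell ((t ^+ 1)%:MP * f r.-1 - t%:MP * f 0%N) <-> dvd ell (f r.-1 - f 0%N).
  by rewrite expr1 -mulrBr dvd_scale.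
split=> [[f [fE /descentP[g gE] /de[h hE]]]|[s [y [y0 ->]]]].
  pose g' : 'rV[S]_r := \row_(i < r) (if (i < r.-1)%N then g i else h).
  have g'E i : (i < r.-1)%N -> entry g' i = g i.
    move=> ir; have lt : (i < r)%N by lia.
    by have := entryE g' (Ordinal lt); rewrite mxE /= ir.
  have g'N : entry g' r.-1 = h.
    have lt : (r.-1 < r)%N by lia.
    by have := entryE g' (Ordinal lt); rewrite mxE /= ltnn.
  have dE i : (i <= r.-1)%N -> descent l (entry g') i = descent l g i.
    by move=> ir; apply: descent_ext => k ki; rewrite g'E //; lia.
  exists (f 0%N), (g' *m LS); split.
    apply/relation_syzygy; rewrite dE // g'N mulrC -hE gE //; ring.
  apply: coef_inj => i lt; rewrite coef_syz_der // -mulmxA forms_mulV // mulmx1.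
  rewrite fE // expr1 dE; last by lia.
  by rewrite gE //; lia.
set g := y *m map_mx (@mpolyC r K) (invmx L).
exists (fun i => s - descent l (entry g) i); split=> [i lt||].
- by rewrite coef_syz_der // expr1.
- by apply/descentP; exists (entry g) => k _; rewrite descent0 subr0.
apply/(de (fun i => s - descent l (entry g) i)); exists (entry g r.-1).
rewrite descent0 subr0.
have := y0; have -> : y = g *m LS by rewrite -mulmxA forms_mulVl // mulmx1.
move/relation_syzygy/eqP; rewrite addr_eq0 => /eqP ->; ring.
Qed.

Local Notation C :=
  (dsum (twist 1 (unit_complex K r)) (twist 1 (truncate 2 (koszul K r)))).

(* The first summand maps to the Euler derivation. *)
Let aug (k : cbas C 0) : 'rV[S]_r :=
  match k with
  | inl _ => syz_der 1 0
  | inr J => syz_der 0 (syzygy [ffun J' => (J' == J)%:R])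
  end.

Lemma augE c : augmap aug c = syz_der (c (inl tt)) (syzygy [ffun I => c (inr I)]).
Proof.
rewrite /augmap big_sumType /= (big_pred1 tt) => [|[]//].
have -> : syz_der (c (inl tt)) (syzygy [ffun I => c (inr I)]) =
    c (inl tt) *: syz_der 1 0 + syz_der 0 (syzygy [ffun I => c (inr I)]).
  by rewrite -syz_der_lin mulr1 addr0 scaler0 add0r.
congr (_ + _); rewrite (@linear_expand _ _ _ (fun b => syz_der 0 (syzygy b))).
  by apply: eq_bigr => I _; rewrite ffunE.
move=> a b b'; rewrite -syz_der_lin mulr0 addr0 -syzygy_lin; congr (syz_der 0 (syzygy _)).
by apply/ffunP => I; rewrite !ffunE.
Qed.

Lemma dmap_inl i (c : {ffun cbas C i.+1 -> S}) u : dmap c (inl u) = 0.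
Proof.
rewrite ffunE big_sumType /= [X in _ + X]big1 ?addr0 => [|I _]; last by rewrite mulr0.
by rewrite big1 // => -[].
Qed.

Lemma dmap_inr i (c : {ffun cbas C i.+1 -> S}) J :
  dmap c (inr J) =
  dmap ([ffun I => c (inr I)] : {ffun cbas (koszul K r) (i + 2).+1 -> S}) J.
Proof.
rewrite !ffunE big_sumType /= big1 ?add0r => [|[]] //.
by apply: eq_bigr => I _; rewrite ffunE.
Qed.

Lemma exact_dsum i (c : {ffun cbas C i -> S}) :
  (forall u, c (inl u) = 0) ->
  (exists b : {ffun cbas (koszul K r) (i + 2).+1 -> S},
     [ffun I => c (inr I)] = dmap b) ->
  exists b : {ffun cbas C i.+1 -> S}, c = dmap b.
Proof.
move=> c0 [b bE]; exists [ffun k => match k with inl _ => 0 | inr J => b J end].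
apply/ffunP => -[u|J]; first by rewrite dmap_inl c0.
rewrite dmap_inr; have := congr1 (fun z : {ffun _ -> S} => z J) bE.
rewrite [LHS]ffunE => ->.
by congr (dmap _ _); apply/ffunP => I; rewrite !ffunE.
Qed.

Lemma koszul_homog p (I : cbas (koszul K r) p.+1) J : cdif I J \is 1.-homog.
Proof.
apply: rpred_sum => i _; rewrite -signr_odd rpredMsign.
by rewrite dhomogX /= mdeg1.
Qed.

Lemma homog1_origin (p : S) : p \is 1.-homog -> p@_0%MM = 0.
Proof. by move/dhomog_nemf_coeff; apply; rewrite /= mdeg0. Qed.

Lemma x_homog i : (i < r)%N -> x i \is 1.-homog.
Proof. by move=> lt; rewrite (linform_ord K lt) dhomogX /= mdeg1. Qed.

Lemma aug_homog (k : cbas C 0) j : aug k 0 j \is (cdeg k).-homog.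
Proof.
have lt := ltn_ord j.
case: k => [u|J]; rewrite -(coefE _ j) coef_syz_der //.
  rewrite mul0mx /descent big1 => [|i _].
    by rewrite subr0 mulr1; apply: x_homog.
  by rewrite /entry; case: insub => [i'|] /=; rewrite ?mxE mulr0.
(* x_j, a form l_i and an entry of a Koszul relation have degree one each. *)
rewrite sub0r mulrN dhomogN -[cdeg _]/(1 + (1 + 1))%N.
apply: dhomogM; first exact: x_homog.
rewrite /descent big_nat_cond; apply: rpred_sum => i /andP[/andP[_ ij] _].
apply: dhomogM.
  by rewrite rpredB ?x_homog //; lia.
rewrite /entry; case: insub => [i'|] /=; last exact: rpred0.
rewrite mxE; apply: rpred_sum => j' _; rewrite [X in _ * X]mxE mulrC mul_mpolyC.
by apply/rpredZ/syzygy_homog.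
Qed.

Lemma resolution_homog i (k : cbas C i.+1) (m : cbas C i) :
  cdif k m \is (cdeg k - cdeg m).-homog /\ ((cdeg k < cdeg m)%N -> cdif k m = 0).
Proof.
case: k m => [[]|I0] [u|J0]; first by rewrite rpred0.
split=> [|/=]; last by lia.
have -> : (cdeg (inr I0 : cbas C i.+1) - cdeg (inr J0 : cbas C i) = 1)%N by rewrite /=; lia.
exact: (@koszul_homog (i + 2)).
Qed.

Lemma resolution_minimal : is_minimal C.
Proof.
move=> i [[]|I0] [u|J0]; first exact: mcoeff0.
exact/homog1_origin/(@koszul_homog (i + 2)).
Qed.

(** A combination of the generators vanishes if and only if its Euler part does and
its Koszul part is a relation among the Koszul relations. *)
Lemma augmap_exact (c : {ffun cbas C 0 -> S}) : t != 1 ->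
  augmap aug c = 0 <-> exists b, c = dmap b.
Proof.
move=> t1; rewrite augE; split=> [E|[b ->]].
  have /syz_der_eq0[//|//|c0 /syzygy_eq0/koszul_cycle[b bE]] := E.
    by apply/syzygyP; eexists.
  by apply: exact_dsum => [[]|] //; exists b.
rewrite dmap_inl; have -> : syzygy [ffun J => dmap b (inr J)] = 0.
  have -> : [ffun J => dmap b (inr J)] =
    dmap ([ffun I => b (inr I)] : {ffun cbas (koszul K r) (0 + 2).+1 -> S}).
    by apply/ffunP => J; rewrite ffunE dmap_inr.
  by apply/syzygy_eq0; apply: dmap_dmap_koszul.
by have := syz_der_lin (-1) 0 0 0 0; rewrite mulr0 addr0 scaler0 addr0 scaleN1r addNr.
Qed.

Lemma resolution_exact i (c : {ffun cbas C i.+1 -> S}) : dmap c = 0 <-> exists b, c = dmap b.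
Proof.
split=> [c0|[b ->]].
  apply: exact_dsum => [[]|]; apply: (@koszul_cycle K r (i + 2)).
  by apply/ffunP => J; rewrite -dmap_inr c0 !ffunE.
apply/ffunP => -[u|J]; first by rewrite dmap_inl ffunE.
rewrite dmap_inr; set c' := [ffun I => _].
have -> : c' = dmap ([ffun I => b (inr I)] : {ffun cbas (koszul K r) (i + 2).+2 -> S}).
  by apply/ffunP => I0; rewrite ffunE (@dmap_inr i.+1).
by rewrite dmap_dmap_koszul !ffunE.
Qed.

Lemma ArtH0_min_resolution : t != 1 ->
  min_free_resolution (derlog (ArtH0 r t) simple) (C := C) aug.
Proof.
move=> t1; split; last exact: resolution_minimal.
split; [exact: aug_homog|exact: resolution_homog| |by move=> c; apply: augmap_exact|exact: resolution_exact].
move=> th; rewrite derlog_syz_der //; split=> [[s [y [/syzygyP[b ->] ->]]]|[c ->]].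
  exists [ffun k => match k with inl _ => s | inr J => b J end].
  rewrite augE ffunE; congr (syz_der _ (syzygy _)).
  by apply/ffunP => J; rewrite !ffunE.
rewrite augE; exists (c (inl tt)), (syzygy [ffun J => c (inr J)]); split=> //.
by apply/syzygyP; eexists.
Qed.

Lemma koszul_basis p : (p <= r)%N -> cbas (koszul K r) p.
Proof.
move=> pr; exists [set i : 'I_r | (i < p)%N].
rewrite -sum1_card (eq_bigl (fun i : 'I_r => (i < p)%N)) => [|i]; last by rewrite inE.
by rewrite (big_ord_narrow pr) sum1_card card_ord.
Qed.

(** The summands S(-1) in degree 0 and S(-(i + 3)) in degree i; the maximum of
b - i is attained in degree 0, where the Koszul part is nonzero. *)
Lemma ArtH0_reg : t != 1 -> has_reg (derlog (ArtH0 r t) simple) 3.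
Proof.
move=> t1; exists C, aug; split; first exact: ArtH0_min_resolution.
  by move=> i [u|J] /=; lia.
have J : cbas (koszul K r) (0 + 2) by apply: koszul_basis; lia.
by exists 0%N, (inr J).
Qed.

(** The Koszul complex ends with its r-th term, which is in degree r - 2 after the
truncation. *)
Lemma ArtH0_pdim : t != 1 -> has_pdim (derlog (ArtH0 r t) simple) (r - 2).
Proof.
move=> t1; apply: (min_resolution_pdim (ArtH0_min_resolution t1)).
  by right; apply: (@koszul_basis (r - 2 + 2)); lia.
move=> i ir; apply: eq_card0 => -[u|[J Jp]]; last first.
  by have := max_card (mem J); rewrite card_ord (eqP Jp); lia.
by case: i ir u.
Qed.

End Restricted.

(** * Derivatives at the origin *)

Section Tangent.
Variables (K : fieldType) (n : nat).
Local Notation S := {mpoly K[n]}.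
Local Notation x i := (linform (xvec K n i)).

(** The derivative at the origin in the direction [v]. *)
Definition tangent (v : nat -> K) (f : S) : K :=
  (derapp (\row_(j < n) (v j)%:MP) f)@_0%MM.

Lemma tangent_linform v a : tangent v (linform a) = \sum_j a 0 j * v j.
Proof.
rewrite /tangent derapp_linform raddf_sum; apply: eq_bigr => i _ /=.
by rewrite mcoeffZ mxE mcoeffC eqxx mulr1.
Qed.

Lemma linform_origin (a : 'rV[K]_n) : (linform a)@_0%MM = 0.
Proof.
rewrite /linform raddf_sum big1 // => j _; rewrite /= mcoeffZ mcoeffX.
by case: eqP => [/mnmP/(_ j)|]; rewrite ?mulr0 // mnm1E eqxx mnm0E.
Qed.

Lemma tangentX v i : (i < n)%N -> tangent v (x i) = v i.
Proof.
move=> lt; rewrite tangent_linform (bigD1 (Ordinal lt)) //= mxE eqxx mul1r.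
rewrite big1 ?addr0 // => j; rewrite -val_eqE /= => /negbTE ij.
by rewrite mxE ij mul0r.
Qed.

Lemma tangent_is_zmod v : zmod_morphism (tangent v).
Proof.
move=> f g; rewrite /tangent -raddfB /derapp -sumrB; congr (_@__).
by apply: eq_bigr => i _; rewrite raddfB mulrBr.
Qed.
HB.instance Definition _ v :=
  GRing.isZmodMorphism.Build S K (tangent v) (tangent_is_zmod v).

(** On polynomials vanishing at the origin, a derivative at the origin only sees the
constant term of a factor. *)
Lemma tangentM v (a f : S) : f@_0%MM = 0 -> tangent v (a * f) = a@_0%MM * tangent v f.
Proof.
move=> f0; rewrite /tangent /derapp !raddf_sum mulr_sumr; apply: eq_bigr => i _ /=.
by rewrite mderivM mulrDr raddfD /= !mcoeff0_mul f0 !mulr0 add0r; ring.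
Qed.

End Tangent.

(** * The arrangement itself *)

Section Cone.
Variable K : fieldType.
Variables (r : nat) (t : K).
Hypotheses (charK : [pchar K] =i pred0) (r3 : (3 <= r)%N) (t0 : t != 0).
Local Notation S := {mpoly K[r.+1]}.
Local Notation x i := (linform (xvec K r.+1 i)).

Let l i : S := x i.+1 - x i.+2.
Let ell : S := x r - t%:MP * x 1%N.
Let w i : S := x i.+1 ^+ 2 - x 0%N ^+ 2.

Lemma derlog_Art theta : derlog (Art r t) simple theta <->
  dvd (x 0%N) (coef theta 0%N) /\
  [/\ forall i, (i < r)%N -> dvd (x i.+1 - x 0%N) (coef theta i.+1 - coef theta 0%N),
      forall i, (i < r)%N -> dvd (x i.+1 + x 0%N) (coef theta i.+1 + coef theta 0%N),
      forall i, (i < r.-1)%N -> dvd (l i) (coef theta i.+1 - coef theta i.+2)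
    & dvd ell (coef theta r - t%:MP * coef theta 1%N)].
Proof.
rewrite (@derlog_forms _ _ _ _ (Art_forms r t)) //; last exact: Art_forms_neq0.
have i1 i : (i \in iota 1 r) -> (i.-1 < r)%N /\ i = i.-1.+1 by rewrite mem_iota; lia.
have i2 i : (i \in iota 1 r.-1) -> (i.-1 < r.-1)%N /\ i = i.-1.+1 by rewrite mem_iota; lia.
have s1 i : (i < r)%N -> i.+1 \in iota 1 r by rewrite mem_iota; lia.
have s2 i : (i < r.-1)%N -> i.+1 \in iota 1 r.-1 by rewrite mem_iota; lia.
split=> [D|[D0 [Dm Dp Dl De]] a]; last first.
  rewrite expr1 inE => /orP[/eqP -> //|]; rewrite !mem_cat.
  case/or4P=> [/mapP[i /i1[lt ->] ->]|/mapP[i /i1[lt ->] ->]|/mapP[i /i2[lt ->] ->]|].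
  - by rewrite derapp_linformB linformB; apply: Dm.
  - by rewrite derapp_linformD linformD; apply: Dp.
  - by rewrite derapp_linformB linformB; apply: Dl.
  rewrite inE => /eqP ->.
  by rewrite derapp_linformB derapp_linformZ linformB linformZ -!mul_mpolyC.
split; first by rewrite -[x 0%N]expr1; apply: D; rewrite inE eqxx.
split=> [i lt|i lt|i lt|].
- rewrite -[X in dvd X]expr1 -linformB /coef -derapp_linformB; apply: D.
  by rewrite inE !mem_cat (map_f (fun i => xvec K r.+1 i - xvec K r.+1 0) (s1 _ lt)) orbT.
- rewrite -[X in dvd X]expr1 -linformD /coef -derapp_linformD; apply: D.
  by rewrite inE !mem_cat (map_f (fun i => xvec K r.+1 i + xvec K r.+1 0) (s1 _ lt)) !orbT.
- rewrite -[X in dvd X]expr1 /l -linformB /coef -derapp_linformB; apply: D.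
  by rewrite inE !mem_cat (map_f (fun i => xvec K r.+1 i - xvec K r.+1 i.+1) (s2 _ lt)) !orbT.
rewrite -[X in dvd X]expr1 /ell !mul_mpolyC -linformZ -linformB.
rewrite /coef -derapp_linformZ -derapp_linformB; apply: D.
by rewrite inE !mem_cat inE eqxx !orbT.
Qed.

Lemma cone_y_prime i : (i < r)%N -> is_prime (x i.+1 - x 0%N).
Proof. by move=> lt; apply: prime_xB; lia. Qed.

Lemma cone_y_ndvd i : (i < r)%N -> ~ dvd (x i.+1 - x 0%N) (x i.+1 + x 0%N).
Proof.
move=> lt; apply: (@not_dvd _ _ (fun=> 1)).
  by rewrite rmorphB /= !evX ?subrr.
by rewrite rmorphD /= !evX // -mulr2n (two_neq0 charK).
Qed.

Lemma cone_l_prime i : (i < r.-1)%N -> is_prime (l i).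
Proof. by move=> lt; apply: prime_xB; lia. Qed.

Lemma cone_ell_prime : is_prime ell.
Proof. by apply: prime_xBZ; lia. Qed.

Lemma cone_l_ndvd i j : (i < r.-1)%N -> (j < r)%N -> ~ dvd (l i) (w j).
Proof.
move=> lt ltj; apply: (@not_dvd _ _ (fun k => (k != 0%N)%:R)).
  by rewrite rmorphB /= !evX ?subrr //; lia.
by rewrite rmorphB !rmorphXn /= !evX //= expr1n expr0n subr0 oner_eq0.
Qed.

Lemma cone_ell_ndvd : ~ dvd ell (w 0).
Proof.
apply: (@not_dvd _ _ (fun k => if k == 0%N then 0 else if k == 1%N then 1 else t)).
  rewrite rmorphB rmorphM /= evC !evX /=; [|lia|lia].
  have -> : (r == 0)%N = false by lia.
  have -> : (r == 1)%N = false by lia.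
  by rewrite mulr1 subrr.
rewrite rmorphB !rmorphXn /= !evX //=; last by lia.
by rewrite expr1n expr0n subr0 oner_eq0.
Qed.

Lemma cone_l_neq0 i : (i < r.-1)%N -> l i != 0.
Proof.
move=> lt; apply: (@neq0_ev _ _ (fun j => (j == i.+1)%:R)).
rewrite rmorphB /= !evX; [|lia|lia].
by rewrite eqxx gtn_eqF // subr0 oner_eq0.
Qed.

Lemma cone_ell_neq0 : ell != 0.
Proof.
apply: (@neq0_ev _ _ (fun j => (j == r)%:R)).
rewrite rmorphB rmorphM /= evC !evX; [|lia|lia].
have -> : (1 == r)%N = false by lia.
by rewrite mulr0 eqxx subr0 oner_eq0.
Qed.

Lemma cone_w_neq0 i : (i < r)%N -> w i != 0.
Proof.
move=> lt; apply: (@neq0_ev _ _ (fun j => (j != 0%N)%:R)).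
by rewrite rmorphB !rmorphXn /= !evX //= expr1n expr0n subr0 oner_eq0.
Qed.

Lemma cone_x_neq0 i : (i < r.+1)%N -> x i != 0.
Proof. by move=> lt; apply: (@neq0_ev _ _ (fun=> 1)); rewrite evX ?oner_eq0. Qed.

(** [s] is the multiple of the Euler derivation to subtract in order to make the
coefficient of d/dx_0 vanish; the other coefficients of the difference are
then divisible by the coprime forms x_i - x_0 and x_i + x_0. *)
Lemma Art_factor theta : derlog (Art r t) simple theta <->
  exists s f, [/\ coef theta 0%N = s * x 0%N,
      forall i, (i < r)%N -> coef theta i.+1 = s * x i.+1 + w i * f i,
      forall i, (i < r.-1)%N -> dvd (l i) (f i - f i.+1)
    & dvd ell (w r.-1 * f r.-1 - w 0%N * (t%:MP * f 0%N))].
Proof.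
have r1 : r.-1.+1 = r by lia.
have chg (f : nat -> S) i : (i < r.-1)%N ->
    dvd (l i) (w i * f i - w i.+1 * f i.+1) <-> dvd (l i) (f i - f i.+1).
  move=> lt; apply: prime_dvdB; [exact: cone_l_prime| |by apply: cone_l_ndvd; lia].
  have -> : w i - w i.+1 = x i.+1 ^+ 2 - x i.+2 ^+ 2 by rewrite /w; ring.
  exact: dvd_subX.
rewrite derlog_Art; split=> [[[s sE] [Dm Dp Dl De]]|[s [f [E0 E Dl De]]]].
  have [|f fE] := @bounded_choice _ (0 : S) r (fun i f => coef theta i.+1 = s * x i.+1 + w i * f).
    move=> i lt; have := Dm i lt; have := Dp i lt; rewrite sE => Pi Mi.
    have {}Mi : dvd (x i.+1 - x 0%N) (coef theta i.+1 - s * x i.+1).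
      have -> : coef theta i.+1 - s * x i.+1 =
        (coef theta i.+1 - s * x 0%N) + (- s) * (x i.+1 - x 0%N) by ring.
      by apply: dvdD => //; exists (- s).
    have {}Pi : dvd (x i.+1 + x 0%N) (coef theta i.+1 - s * x i.+1).
      have -> : coef theta i.+1 - s * x i.+1 =
        (coef theta i.+1 + s * x 0%N) + (- s) * (x i.+1 + x 0%N) by ring.
      by apply: dvdD => //; exists (- s).
    have [f fE] := prime_mul_dvd (cone_y_prime lt) (cone_y_ndvd lt) Mi Pi.
    exists f; rewrite /w subr_sqr [_ * f]mulrC -fE; ring.
  exists s, f; split=> // [i lt|].
    rewrite -chg //.
    have -> : w i * f i - w i.+1 * f i.+1 =
       (coef theta i.+1 - coef theta i.+2) + (- s) * l i.
      by rewrite !fE /l; [ring|lia|lia].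
    by apply: dvdD; [apply: Dl|exists (- s)].
  have -> : w r.-1 * f r.-1 - w 0%N * (t%:MP * f 0%N) =
       (coef theta r - t%:MP * coef theta 1%N) + (- s) * ell.
    have := fE r.-1; rewrite r1 => -> //; rewrite fE /ell; [ring|lia].
  by apply: dvdD; [apply: De|exists (- s)].
split; first by exists s.
split=> [i lt|i lt|i lt|].
- rewrite E // E0; exists (s + (x i.+1 + x 0%N) * f i); rewrite /w; ring.
- rewrite E // E0; exists (s + (x i.+1 - x 0%N) * f i); rewrite /w; ring.
- rewrite !E; [|lia|lia].
  have -> : s * x i.+1 + w i * f i - (s * x i.+2 + w i.+1 * f i.+1) =
     (w i * f i - w i.+1 * f i.+1) + s * l i by rewrite /l; ring.
  by apply: dvdD; [rewrite chg //; apply: Dl|exists s].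
have -> : coef theta r - t%:MP * coef theta 1%N =
   (w r.-1 * f r.-1 - w 0%N * (t%:MP * f 0%N)) + s * ell.
  have := E r.-1; rewrite r1 => -> //; rewrite E /ell; [ring|lia].
by apply: dvdD; [apply: De|exists s].
Qed.

Definition cone_der (s : S) (f : nat -> S) : 'rV[S]_r.+1 :=
  \row_(j < r.+1) (s * x j + (0 < j)%N%:R * (w j.-1 * f j.-1)).

Lemma cone_der0 s f : coef (cone_der s f) 0 = s * x 0%N.
Proof.
rewrite (coef_row (fun j => s * x j + (0 < j)%N%:R * (w j.-1 * f j.-1))) //.
by rewrite mul0r addr0.
Qed.

Lemma cone_derS s f i : (i < r)%N -> coef (cone_der s f) i.+1 = s * x i.+1 + w i * f i.
Proof.
move=> lt; rewrite (coef_row (fun j => s * x j + (0 < j)%N%:R * (w j.-1 * f j.-1))) //.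
by rewrite mul1r.
Qed.

Lemma cone_der_lin a s s' f f' :
  cone_der (a * s + s') (fun k => a * f k + f' k) = a *: cone_der s f + cone_der s' f'.
Proof.
apply: coef_inj => -[|i] lt; rewrite coef_lin ?cone_der0 ?cone_derS //; ring.
Qed.

Lemma cone_der_ext s f f' : (forall i, (i < r)%N -> f i = f' i) ->
  cone_der s f = cone_der s f'.
Proof.
by move=> E; apply: coef_inj => -[|i] lt; rewrite ?cone_der0 ?cone_derS ?E.
Qed.

Lemma cone_der_eq0 s f : cone_der s f = 0 -> s = 0 /\ forall i, (i < r)%N -> f i = 0.
Proof.
move=> E; have s0 : s = 0.
  have := cone_der0 s f; rewrite E coef_zero => /esym/eqP.
  by rewrite mulf_eq0 (negbTE (cone_x_neq0 _)) // orbF => /eqP.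
split=> // i lt; have := cone_derS s f lt; rewrite E coef_zero s0 mul0r add0r => /esym/eqP.
by rewrite mulf_eq0 (negbTE (cone_w_neq0 lt)) // => /eqP.
Qed.

Lemma derlog_cone_der theta : derlog (Art r t) simple theta <->
  exists s f, [/\ theta = cone_der s f,
      forall i, (i < r.-1)%N -> dvd (l i) (f i - f i.+1)
    & dvd ell (w r.-1 * f r.-1 - w 0%N * (t%:MP * f 0%N))].
Proof.
rewrite Art_factor; split=> -[s [f]]; last first.
  move=> [-> Dl De]; exists s, f; split=> //; first exact: cone_der0.
  exact: cone_derS.
move=> [E0 E Dl De]; exists s, f; split=> //; apply: coef_inj => -[|i] lt.
  by rewrite cone_der0.
by rewrite cone_derS ?E.
Qed.

(** For t = -1 the form [ell] divides w_r - w_1, so that the weights cancel in the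
last condition too and [cyclic] applies, with the Euler coefficient as an
additional parameter. *)
Lemma Art_free : t != 1 -> t = -1 -> is_free (derlog (Art r t) simple).
Proof.
move=> t1 tN1; pose d : S := ((t - 1)^-1)%:MP.
have dc : d * (t%:MP - 1) = 1.
  by rewrite /d -mpolyC1 -mpolyCB -mpolyCM mulVf ?subr_eq0.
have tt : t%:MP * t%:MP = 1 :> S by rewrite -mpolyCM tN1 mulrNN mulr1.
have che (f : nat -> S) : dvd ell (w r.-1 * f r.-1 - w 0%N * (t%:MP * f 0%N)) <->
    dvd ell (t%:MP * f r.-1 - f 0%N).
  have r1 : r.-1.+1 = r by lia.
  rewrite prime_dvdB; [|exact: cone_ell_prime| |exact: cone_ell_ndvd].
    by rewrite -(dvd_scale _ _ t0) mulrBr mulrA tt mul1r.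
  exists (x r - x 1%N); rewrite /w /ell r1 tN1 rmorphN rmorph1 /=; ring.
pose ch := cyclic l ell t%:MP d r.-1.
apply: (@free_of_parametrization _ _ _ r.+1 (fun g => cone_der (g r) (ch g))).
- move=> a g h; rewrite -cone_der_lin; apply: cone_der_ext => i _.
  exact: cyclic_lin.
- move=> g h E; rewrite (E r) //; apply: cone_der_ext => i lt.
  by apply: cyclic_ext; [move=> j jr; apply: E|]; lia.
- move=> theta; rewrite derlog_cone_der; split=> [[s [f [-> Dl De]]]|[g ->]].
    have [g gE] : exists g, forall k, (k <= r.-1)%N -> f k = ch g k.
      by apply/(cyclicP l ell r.-1 dc); split=> //; apply/che.
    exists (fun k => if k == r then s else g k); rewrite eqxx; apply: cone_der_ext => i lt.
    rewrite gE; last by lia.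
    by apply: cyclic_ext => [j jr|]; [rewrite ltn_eqF //|]; lia.
  have [Dl De] := (cyclicP l ell r.-1 dc (ch g)).2 (ex_intro _ g (fun k _ => erefl)).
  by exists (g r), (ch g); split=> //; apply/che.
move=> g /cone_der_eq0[gr ch0] k; rewrite ltnS leq_eqVlt => /orP[/eqP -> //|kr].
apply: (@cyclic_inj _ l ell t%:MP d r.-1) => //; last by lia.
- by move=> i b lt /eqP; rewrite mulf_eq0 (negbTE (cone_l_neq0 lt)) => /eqP.
- by move=> b /eqP; rewrite mulf_eq0 (negbTE cone_ell_neq0) => /eqP.
by move=> i ir; apply: ch0; lia.
Qed.

(** The last condition on the plane of the points (Y, X, ..., X, tX, ..., tX), in
K[X][Y].  Divided by t - 1 it reads (t X^2 + Y^2) F + (t^2 X^2 - Y^2) X G = 0,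
whose coefficients of 1 and Y^2 give F_0 = - t X G_0 and then X | (t + 1) G_0. *)
Lemma plane_vanish (F G : {poly {poly K}}) : t != -1 ->
  ((t ^+ 2 *: 'X ^+ 2)%:P - 'X ^+ 2) * (F - ((1 - t) *: 'X)%:P * G)
    - ((('X : {poly K}) ^+ 2)%:P - 'X ^+ 2) * ((t%:P)%:P * F) = 0 ->
  t != 1 -> F`_0`_0 = 0 /\ G`_0`_0 = 0.
Proof.
move=> tN1 E t1.
pose T : {poly K} := t%:P; pose X : {poly K} := 'X.
have T1 : T - 1 != 0 by rewrite -polyC1 -polyCB polyC_eq0 subr_eq0.
have T0 : T != 0 by rewrite polyC_eq0.
have TN1 : T + 1 != 0 by rewrite -polyC1 -polyCD polyC_eq0 addr_eq0.
have X0 : X != 0 by rewrite polyX_eq0.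
have {}E : (T - 1)%:P * ((T * X ^+ 2)%:P * F + 'X^2 * F
    + (T ^+ 2 * X ^+ 3)%:P * G - 'X^2 * (X%:P * G)) = 0.
  rewrite -[RHS]E -!mul_polyC -/T -/X.
  have -> : (1 - t)%:P = 1 - T by rewrite polyCB polyC1.
  rewrite polyC_exp -/T !(polyCB, polyCM, polyC_exp, polyC1).
  ring.
move/eqP: E; rewrite mulf_eq0 polyC_eq0 (negbTE T1) /= => /eqP E.
have E0 := congr1 (fun p : {poly {poly K}} => p`_0) E.
have E2 := congr1 (fun p : {poly {poly K}} => p`_2) E.
rewrite !(coefB, coefD, coefCM, coefXnM) /= !coef0 in E0 E2.
have {}E0 : F`_0 = - (T * X * G`_0).
  apply: (mulfI (mulf_neq0 T0 (expf_neq0 2 X0))).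
  by rewrite -[LHS]subr0 -[X in _ - X]E0; ring.
have {}E2 : (T + 1) * G`_0 = X * (T * F`_2 + T ^+ 2 * X * G`_2).
  apply: (mulfI X0); rewrite -[RHS]subr0 -[X in _ - X]E2 subnn E0; ring.
split; first by rewrite E0 -mulrA mulrCA coefN coefXM /= oppr0.
have := congr1 (fun p : {poly K} => p`_0) E2.
rewrite coefXM /= /T -polyC1 -polyCD coefCM => /eqP; rewrite mulf_eq0 addr_eq0.
by rewrite (negbTE tN1) => /eqP.
Qed.

Lemma coef_origin n (H : nat -> {poly {poly K}}) (f : {mpoly K[n]}) :
  (forall i, (i < n)%N -> (H i)`_0`_0 = 0) ->
  (ev (polyC \o polyC : {rmorphism K -> {poly {poly K}}}) H f)`_0`_0 = f@_0%MM.
Proof.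
move=> H0; elim/mpoly_alg_ind: f => [c|i lt|p q Ep Eq|p q Ep Eq].
- by rewrite evC /= !coefC /= mcoeffC eqxx mulr1.
- rewrite evX // H0 // (linform_ord _ lt) mcoeffX.
  by case: eqP => // /mnmP/(_ (Ordinal lt)); rewrite mnm1E eqxx mnm0E.
- by rewrite rmorphD /= !coefD Ep Eq raddfD.
by rewrite rmorphM /= !coef0M Ep Eq mcoeff0_mul.
Qed.

(** On the plane where the first k+1 of the coordinates x_1, ..., x_r are X and the
others are t X, the forms [ell] and [l i] vanish except for [l k] = (1 - t) X.
There all the f_i with i <= k agree, as do those with i > k, and only [g k]
survives. *)
Lemma origin_vanish f g : t != 1 -> t != -1 ->
    (forall k, (k <= r.-1)%N -> f k = f 0%N - descent l g k) ->
    dvd ell (w r.-1 * f r.-1 - w 0%N * (t%:MP * f 0%N)) ->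
  (f 0%N)@_0%MM = 0 /\ forall k, (k < r.-1)%N -> (g k)@_0%MM = 0.
Proof.
move=> t1 tN1 fE [q De].
suff van k : (k < r.-1)%N -> (f 0%N)@_0%MM = 0 /\ (g k)@_0%MM = 0.
  by split=> [|k /van[]] //; have [|] // := van 0%N; lia.
move=> kr; pose a i : K := if (i <= k.+1)%N then 1 else t.
pose H i : {poly {poly K}} := if i == 0%N then 'X else (a i *: 'X)%:P.
have H0 i : (H i)`_0`_0 = 0.
  rewrite /H; case: ifP => _; first by rewrite coefX coef0.
  by rewrite coefC /= coefZ coefX mulr0.
pose sg : {rmorphism S -> {poly {poly K}}} :=
  ev (polyC \o polyC : {rmorphism K -> {poly {poly K}}}) H.
have sx i : (0 < i)%N -> (i < r.+1)%N -> sg (x i) = (a i *: 'X)%:P.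
  by case: i => // i _ ir; rewrite /sg evX.
have sl i : (i < r.-1)%N -> i != k -> sg (l i) = 0.
  move=> ir ik; rewrite rmorphB !sx; [|lia|lia|lia|lia].
  rewrite /a; case: ifP; case: ifP; rewrite ?subrr //; lia.
have sd j : (j <= r.-1)%N ->
    sg (descent l g j) = if (k < j)%N then sg (l k) * sg (g k) else 0.
  elim: j => [|j IH] jr; first by rewrite descent0 rmorph0.
  rewrite descentS rmorphD rmorphM IH; last by lia.
  have [->|jk] := eqVneq j k; first by rewrite ltnn ltnSn add0r.
  have -> : (k < j.+1)%N = (k < j)%N by lia.
  by rewrite (sl j) // mul0r addr0.
have slk : sg (l k) = ((1 - t) *: 'X)%:P.
  rewrite rmorphB !sx; [|lia|lia|lia|lia].
  rewrite /a leqnn ltnn -polyCB -scalerBl //.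
have r1 : r.-1.+1 = r by lia.
have aN : a r = t by rewrite /a; case: ifP => //; lia.
have sfN : sg (f r.-1) = sg (f 0%N) - sg (l k) * sg (g k).
  by rewrite fE // rmorphB sd // kr.
have sw i : (i < r)%N -> sg (w i) = (a i.+1 ^+ 2 *: 'X ^+ 2)%:P - 'X ^+ 2.
  move=> ir; rewrite rmorphB !rmorphXn sx //= [sg (x 0%N)]evX // /H eqxx.
  by rewrite -polyC_exp exprZn.
have := congr1 sg De.
rewrite rmorphB !rmorphM [sg t%:MP]evC /= !sw; [|lia|lia].
rewrite r1 aN sfN slk rmorphB rmorphM [sg t%:MP]evC !sx; [|lia|lia|lia|lia].
rewrite aN /a /= ?scale1r -[t *: 'X]mul_polyC polyCM subrr mulr0 expr1n scale1r => E.
have := plane_vanish tN1 E t1.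
by rewrite /sg !coef_origin // => -[-> ->].
Qed.

(** All the unknowns as one sequence: [h 0] is the coefficient of the Euler
derivation, [h 1] is the first f, and [h k.+2] is [g k]. *)
Definition param_der (h : nat -> S) : 'rV[S]_r.+1 :=
  cone_der (h 0%N) (fun k => h 1%N - descent l (fun i => h i.+2) k).

Definition param_cond (h : nat -> S) : Prop :=
  dvd ell (w r.-1 * (h 1%N - descent l (fun i => h i.+2) r.-1) - w 0%N * (t%:MP * h 1%N)).

Lemma derlog_param theta : derlog (Art r t) simple theta <->
  exists h, theta = param_der h /\ param_cond h.
Proof.
rewrite derlog_cone_der; split=> [[s [f [-> /descentP[g gE] De]]]|[h [-> De]]].
  pose h k := if k is k'.+1 then if k' is k''.+1 then g k'' else f 0%N else s.
  exists h; split; last by rewrite /param_cond /= -gE.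
  by apply: cone_der_ext => i ir; rewrite gE //; lia.
exists (h 0%N), (fun k => h 1%N - descent l (fun i => h i.+2) k); split=> //.
  by apply/descentP; exists (fun i => h i.+2) => k _; rewrite descent0 subr0.
by rewrite descent0 subr0.
Qed.

Lemma param_der_lin a h h' :
  param_der (fun k => a * h k + h' k) = a *: param_der h + param_der h'.
Proof.
rewrite -cone_der_lin; apply: cone_der_ext => i _.
by rewrite (descent_lin l a (fun i => h i.+2)); ring.
Qed.

Lemma param_der_sum (I : Type) (s : seq I) (a : I -> S) (h : I -> nat -> S) :
  param_der (fun k => \sum_(i <- s) a i * h i k) = \sum_(i <- s) a i *: param_der (h i).
Proof.
have T0 g : (forall k, g k = 0) -> param_der g = 0.
  move=> g0; apply: coef_inj => -[|i] lt; rewrite coef_zero.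
    by rewrite cone_der0 g0 mul0r.
  rewrite cone_derS // !g0 (@descent_ext _ _ _ (fun=> 0)) => [|j _]; last exact: g0.
  by rewrite /descent big1 ?mul0r ?subr0 ?mulr0 ?addr0 // => j _; rewrite mulr0.
have Te g g' : g =1 g' -> param_der g = param_der g'.
  move=> E; rewrite /param_der E; apply: cone_der_ext => k _; rewrite E; congr (_ - _).
  by apply: descent_ext => i _; rewrite E.
elim: s => [|i s IH]; first by rewrite big_nil; apply: T0 => k; rewrite big_nil.
by rewrite big_cons -IH -param_der_lin; apply: Te => k; rewrite big_cons.
Qed.

Lemma param_der_inj h h' : param_der h = param_der h' ->
  forall k, (k < r.+1)%N -> h k = h' k.
Proof.
move=> E; have E0 : param_der (fun k => -1 * h k + h' k) = 0.
  by rewrite param_der_lin scaleN1r E addNr.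
suff z k : (k < r.+1)%N -> -1 * h k + h' k = 0.
  by move=> k /z /eqP; rewrite mulN1r addrC subr_eq0 => /eqP.
have [h0 f0] := cone_der_eq0 E0.
have [||h1 hS] := @descent_inj _ l (fun i => -1 * h i.+2 + h' i.+2) r.-1
  (-1 * h 1%N + h' 1%N).
- by move=> i b lt /eqP; rewrite mulf_eq0 (negbTE (cone_l_neq0 lt)) => /eqP.
- by move=> i ir; apply: f0; lia.
by case: k => [|[|k]] // kr; apply: hS; lia.
Qed.

Lemma param_origin h : t != 1 -> t != -1 -> param_cond h ->
  forall k, (k < r)%N -> (h k.+1)@_0%MM = 0.
Proof.
move=> t1 tN1 hc.
have [] := @origin_vanish (fun k => h 1%N - descent l (fun i => h i.+2) k)
  (fun i => h i.+2) t1 tN1.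
- by move=> k _; rewrite descent0 subr0.
- by rewrite descent0 subr0.
rewrite descent0 subr0 => h1 hS [|k] // kr; apply: hS; lia.
Qed.

(** Members that any generating set must account for: the Euler derivation, the
multiples by [ell] of the unit vectors for f and for the g's, and, for the
index r + 1, the Koszul relation between the first two differences. *)
Definition witness (j k : nat) : S :=
  if j == r.+1 then (k == 2)%:R * l 1 - (k == 3)%:R * l 0
  else (j == k)%:R * (if k == 0%N then 1 else ell).

Lemma witness_cond j : param_cond (witness j).
Proof.
have cond h p d : h 1%N = p * ell -> descent l (fun i => h i.+2) r.-1 = d * ell -> param_cond h.
  rewrite /param_cond => -> ->.
  by exists (w r.-1 * (p - d) - w 0%N * (t%:MP * p)); ring.
have [E|jr] := eqVneq j r.+1.
  apply: (cond _ 0 0); rewrite ?mul0r /witness E eqxx ?mul0r ?subrr //.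
  have -> : r.-1 = (r - 3).+2 by lia.
  rewrite /descent !big_nat_recl // big1 => [|i _]; rewrite !eqSS /=.
    by rewrite !mul1r !mul0r; ring.
  by rewrite !mul0r subr0 mulr0.
apply: (cond _ (j == 1%N)%:R (\sum_(0 <= i < r.-1) l i * (j == i.+2)%:R)).
  by rewrite /witness (negbTE jr).
by rewrite mulr_suml /witness (negbTE jr); apply: eq_bigr => i _ /=; rewrite mulrA.
Qed.

(** The functionals that separate the [witness]es: the value at the origin of the
Euler coefficient, and derivatives at the origin.  Along (0, 1, ..., 1) the
differences have derivative 0 and [ell] has derivative 1 - t; the derivative
with respect to x_2 detects the Koszul relation. *)
Definition cotangent (q : nat) (h : nat -> S) : K :=
  if q == 0%N then (h 0%N)@_0%MM
  else if q == r.+1 then tangent (fun i => (i == 2)%:R) (h 3)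
  else tangent (fun i => (0 < i)%N%:R) (h q).

(** Since the unknowns other than [h 0] vanish at the origin, the functionals only
see the constant terms of the coefficients of a combination. *)
Lemma cotangent_sum (I : finType) (a : I -> S) (h : I -> nat -> S) q :
    t != 1 -> t != -1 -> (forall i, param_cond (h i)) -> (q < r.+2)%N ->
  cotangent q (fun k => \sum_i a i * h i k) = \sum_i (a i)@_0%MM * cotangent q (h i).
Proof.
move=> t1 tN1 hc qr; rewrite /cotangent; case: eqVneq => [_|q0].
  by rewrite raddf_sum; apply: eq_bigr => i _ /=; rewrite mcoeff0_mul.
case: eqVneq => [_|qn]; rewrite raddf_sum; apply: eq_bigr => i _ /=; rewrite tangentM //.
  by apply: (param_origin t1 tN1 (hc i) (k := 2)); lia.
have -> : q = q.-1.+1 by lia.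
by apply: (param_origin t1 tN1 (hc i)); lia.
Qed.

Lemma cotangent_witness a b : (b < r.+2)%N ->
  cotangent b (witness a) = (a == b)%:R * (if (b == 0%N) || (b == r.+1) then 1 else 1 - t).
Proof.
move=> qb; have tl v i : (i < r.-1)%N -> tangent v (l i) = v i.+1 - v i.+2.
  by move=> ir; rewrite raddfB /= !tangentX //; lia.
have te v : tangent v ell = v r - t * v 1%N.
  rewrite raddfB /= tangentX // tangentM ?linform_origin // mcoeffC eqxx mulr1.
  by rewrite tangentX //; lia.
rewrite /cotangent /witness /=.
case: (eqVneq b 0%N) => [->|b0].
  case: (eqVneq a r.+1) => [->|ar] /=; first by rewrite !mul0r subr0 mcoeff0.
  by rewrite !mulr1; case: (a == 0%N); rewrite /= ?mulr0n ?mulr1n ?mcoeff1 ?mcoeff0 ?eqxx.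
case: (eqVneq b r.+1) => [->|br] /=.
  case: (eqVneq a r.+1) => [_|ar] /=.
    by rewrite mul0r sub0r mul1r raddfN /= tl /=; [rewrite mul1r; ring|lia].
  case: (a == 3); rewrite ?mul0r ?raddf0 // mul1r te.
  have -> : (r == 2)%N = false by lia.
  by rewrite /= mulr0 subr0.
case: (eqVneq a r.+1) => [->|ar] /=.
  rewrite [r.+1 == b]eq_sym (negbTE br) mul0r raddfB /=.
  have tz v k i : (i < r.-1)%N -> v i.+1 = v i.+2 -> tangent v (k%:R * l i) = 0.
    move=> ir vi; rewrite tangentM ?tl ?vi ?subrr ?mulr0 //.
    by rewrite raddfB /= !linform_origin subrr.
  by rewrite !tz ?subrr //; lia.
case: (a == b); rewrite ?mul0r ?raddf0 // !mul1r te.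
have -> : (0 < r)%N by apply: leq_trans r3.
by rewrite mulr1.
Qed.

(** The functionals give an invertible diagonal matrix of size r + 2 on the
witnesses, which factors through the number of generators. *)
Lemma Art_not_free : t != 1 -> t != -1 -> ~ is_free (derlog (Art r t) simple).
Proof.
move=> t1 tN1 free.
have eD (j : 'I_r.+2) : derlog (Art r t) simple (param_der (witness j)).
  by apply/derlog_param; exists (witness j); split=> //; apply: witness_cond.
have [k [b [a [kr bD ba]]]] := free_generators free eD.
have [h hb] := fin_all_exists (fun i => (derlog_param (b i)).1 (bD i)).
have hE (j q : 'I_r.+2) :
    cotangent q (witness j) = \sum_i (a j i)@_0%MM * cotangent q (h i).
  rewrite -cotangent_sum // => [|i]; last by case: (hb i).
  have E q' : (q' < r.+1)%N -> witness j q' = \sum_i a j i * h i q'.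
    apply: (@param_der_inj (witness j) (fun k => \sum_i a j i * h i k)).
    by rewrite param_der_sum ba; apply: eq_bigr => i _; case: (hb i) => ->.
  rewrite /cotangent; case: eqVneq => _; first by rewrite E.
  case: eqVneq => qr; first by rewrite E.
  by rewrite E //; have := ltn_ord q; lia.
pose A := \matrix_(j < r.+2, i < k) (a j i)@_0%MM.
pose B := \matrix_(i < k, q < r.+2) cotangent q (h i).
pose v : 'rV[K]_r.+2 :=
  \row_q (if (q == 0 :> nat)%N || (q == r.+1 :> nat)%N then 1 else 1 - t).
have AB : A *m B = diag_mx v.
  apply/matrixP => j q; rewrite !mxE.
  have := hE j q; rewrite cotangent_witness // => E.
  rewrite (eq_bigr (fun i => (a j i)@_0%MM * cotangent q (h i))) => [|i _]; last first.
    by rewrite !mxE.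
  by rewrite -E val_eqE; case: eqVneq => [->|_]; rewrite ?mul0r ?mul1r.
have : \rank (diag_mx v) = r.+2.
  apply: mxrank_unit; rewrite unitmxE det_diag unitfE; apply/prodf_neq0 => q _.
  by rewrite mxE; case: ifP => _; rewrite ?oner_eq0 // subr_eq0 eq_sym.
have := mulmx_max_rank A B; rewrite AB => le1 E; move: le1; rewrite E; lia.
Qed.

End Cone.

Theorem proposition6p12 (K : fieldType) (charK : [pchar K] =i pred0)
    (r : nat) (r_ge3 : (3 <= r)%N) (t : K) (t_neq0 : t != 0) (t_neq1 : t != 1) :
  [/\ is_free (derlog (ArtH0 r t) (mH0 r t)),
      is_free (derlog (Art r t) simple) <-> t = -1
    & [/\ exists e, min_free_resolution (derlog (ArtH0 r t) simple)
            (C := dsum (twist 1 (unit_complex K r))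
                       (twist 1 (truncate 2 (koszul K r)))) e,
          has_reg (derlog (ArtH0 r t) simple) 3
        & has_pdim (derlog (ArtH0 r t) simple) (r - 2)]].
Proof.
split; first exact: ziegler_free.
  split=> [free|]; last exact: Art_free.
  by apply/eqP/negPn/negP => tN1; case: (Art_not_free charK r_ge3 t_neq0 t_neq1 tN1).
split; last exact: ArtH0_pdim; last exact: ArtH0_reg.
by eexists; apply: ArtH0_min_resolution.
Qed.
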